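(* Let $g:D\to(-\infty,0]$ be Borel measurable and let $m$ be a non-trivial $\sigma$-finite Borel measure on $D$. Suppose (Eig) holds: there are $\lambda_D\ge0$ and a Borel function $\varphi_D:D\to[0,\infty)$ with $\int_D\varphi_D\,dm>0$ and $P^D_t\varphi_D(x)=e^{-\lambda_Dt}\varphi_D(x)$ for all $t\ge0$, $x\in D$. Then for any $u\in\mathcal U_c^+(g)$, $$\bar u_{D_S}-u(x)\ge\frac{\varphi_D(x)}{2e\|\varphi_D\|_\infty}\left(\frac{\underline c_D\,\bar u_{D_S}}{\lambda_D+\underline c_D}+\frac{\underline g^-_D}{\lambda_D+\bar c_D}\right),\qquad x\in D,$$ where $\underline c_D=\inf_Dc$, $\bar c_D=\sup_Dc$, $g^-=\max\{-g,0\}$, $\underline g^-_D=\inf_Dg^-$ and $\|\varphi_D\|_\infty=\sup_D\varphi_D$.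
   Context: Setting and standing assumptions. $D\subset\mathbb R^d$ is a domain (open connected set). $B_b(E)$ denotes the bounded Borel functions on $E$. $A$ is the operator $$Au(x)=\tfrac12\mathrm{Tr}(\mathbf Q(x)\nabla^2u(x))+b(x)\cdot\nabla u(x)+\int_{\mathbb R^d}\Big(u(x+y)-u(x)-\frac{y\cdot\nabla u(x)}{1+|y|^2}\Big)N(x,dy).$$ (A1) The entries of the symmetric non-negative definite matrix $\mathbf Q(x)$ and of the vector $b(x)$ are bounded Borel functions on $\mathbb R^d$. (A2) $N(x,dy)$ is a kernel of $\sigma$-finite Borel measures on $\mathbb R^d\setminus\{0\}$ with $\sup_x\int\min\{1,|y|^2\}N(x,dy)<\infty$. (A3) $c:D\to[0,\infty)$ is bounded and Borel. (A4) There is a strong Markovian solution $(P_x)_{x\in\mathbb R^d}$ of the martingale problem for $A$, which is fixed: Borel probability measures on the Skorokhod space of càdlàg paths $[0,\infty)\to\mathbb R^d$ with canonical process $X_t$ and natural filtration $(\mathcal F_t)$, such that $P_x(X_0=x)=1$; for each $f\in C_b^2(\mathbb R^d)$ the process $f(X_t)-f(X_0)-\int_0^tAf(X_r)dr$ is a $P_x$-martingale; $x\mapsto P_x[C]$ is measurable for Borel $C$; $X$ is strong Markov; and $P_\mu=\int P_x\,\mu(dx)$ solves the martingale problem with initial law $\mu$ for every Borel probability measure $\mu$. $\mathbb E_x$ is expectation under $P_x$. Let $\tau_D=\inf\{t>0:X_t\notin D\}$. (ET) $P_x(\tau_D<\infty)=1$ for all $x\in D$. $P^D_tf(x)=\mathbb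 E_x[f(X_t);\,t<\tau_D]$. Extended closure: $\mathcal S(D)=\bigcup_{x\in D}(x+\mathrm{supp}\,N(x,\cdot))$, $\partial_SD=\partial D\cup(\mathcal S(D)\setminus D)$, $D_S=D\cup\partial_SD$; $\bar u_B=\sup_Bu$. Subsolutions: with $e_c(t)=\exp\{-\int_0^tc(X_r)dr\}$, $u\in B_b(\mathbb R^d)$ is a weak subsolution of $(-A+c)v=g$ in $D$ if $u(x)\le\mathbb E_x[e_c(\tau_D\wedge t)u(X_{\tau_D\wedge t})]+\mathbb E_x[\int_0^{\tau_D\wedge t}e_c(r)g(X_r)dr]$ for all $x\in D$, $t\ge0$. $\mathcal U_c^+(g)$ is the set of such $u$ with $\bar u_{D_S}\ge0$. Convention: if $\varphi_D$ is unbounded ($\|\varphi_D\|_\infty=+\infty$) the right-hand side is read as $0$. *)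

(* Defs.v *)
From HB Require Import structures.
From mathcomp Require Import all_boot all_order all_algebra.
From mathcomp Require Import all_classical all_reals all_analysis.
Set Implicit Arguments.
Unset Strict Implicit.
Unset Printing Implicit Defensive.
Import Order.TTheory GRing.Theory Num.Theory.
Import numFieldTopology.Exports numFieldNormedType.Exports.
Local Open Scope classical_set_scope.
Local Open Scope ring_scope.

(* Borel sigma-algebra on matrices, in particular on 'rV[R]_d. *)
HB.instance Definition _ (R : realType) (m n : nat) :=
  Measurable.copy 'M[R]_(m, n) (g_sigma_algebraType (@open 'M[R]_(m, n))).

Definition bounded_on (T : Type) (R : realType) (A : set T) (f : T -> R) :=
  exists K : R, forall x, A x -> `|f x| <= K.

(* B_b(E) *)
Definition bounded_borel (e : measure_display) (T : measurableType e)
    (R : realType) (f : T -> R) :=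
  measurable_fun setT f /\ bounded_on setT f.

Section operator.
Variables (R : realType) (d : nat).
Local Notation V := 'rV[R]_d.
Implicit Types (f : V -> R) (x y : V).

(* The norm of the library on 'rV[R]_d is the sup norm; the Euclidean
   structure is given by [dot]. *)
Definition dot x y : R := \sum_(i < d) x 0 i * y 0 i.

Definition pderiv (i : 'I_d) f : V -> R := fun x => 'D_(delta_mx 0 i) f x.

Definition grad f x : V := \row_i pderiv i f x.

Definition hessian f x : 'M[R]_d := \matrix_(i, j) pderiv i (pderiv j f) x.

Definition Cb f := continuous f /\ bounded_on setT f.

(* C_b^2(R^d): bounded and continuous, together with all partial derivatives
   of order at most 2. *)
Definition Cb2 f :=
  [/\ Cb f,
      forall i : 'I_d, (forall x, derivable f x (delta_mx 0 i)) /\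
        Cb (pderiv i f) &
      forall i j : 'I_d, (forall x, derivable (pderiv j f) x (delta_mx 0 i)) /\
        Cb (pderiv i (pderiv j f))].

(* A measure on R^d \ {0} is a measure on R^d which does not charge 0. *)
Definition levy_op (Q : V -> 'M[R]_d) (b : V -> V) (N : R.-ker V ~> V)
    f x : R :=
  2^-1 * \tr (Q x *m hessian f x) + dot (b x) (grad f x) +
  \int[N x]_y (f (x + y) - f x - dot y (grad f x) / (1 + dot y y)).

Definition assumption_A1 (Q : V -> 'M[R]_d) (b : V -> V) :=
  [/\ forall x, (Q x)^T = Q x,
      forall x (v : V), 0 <= (v *m Q x *m v^T) 0 0,
      forall i j, bounded_borel (fun x => Q x i j) &
      forall i, bounded_borel (fun x => b x 0 i)].

Definition assumption_A2 (N : R.-ker V ~> V) :=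
  [/\ forall x, N x [set 0] = 0%E,
      forall x, sigma_finite setT (N x) &
      (ereal_sup (range (fun x => \int[N x]_y (Num.min 1 (dot y y))%:E)) < +oo)%E].

Definition assumption_A3 (D : set V) (c : V -> R) :=
  [/\ measurable_fun D c, forall x, D x -> 0 <= c x & bounded_on D c].

Definition measure_support (mu : set V -> \bar R) : set V :=
  [set y | forall U, open U -> U y -> (0 < mu U)%E].

Definition jump_range (N : R.-ker V ~> V) (D : set V) : set V :=
  \bigcup_(x in D) [set x + y | y in measure_support (N x)].

Definition boundary (D : set V) : set V := closure D `\` interior D.

Definition boundary_S (N : R.-ker V ~> V) (D : set V) : set V :=
  boundary D `|` (jump_range N D `\` D).

Definition closure_S (N : R.-ker V ~> V) (D : set V) : set V :=
  D `|` boundary_S N D.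

End operator.

Section skorokhod_space.
Variables (R : realType) (d : nat).
Local Notation V := 'rV[R]_d.

(* Paths are indexed by [0, +oo[; they are encoded as functions on R frozen at
   their initial value at negative times, so that Leibniz equality of paths is
   equality on [0, +oo[. *)
Definition cadlag (w : R -> V) :=
  [/\ forall t, 0 <= t -> w s @[s --> t^'+] --> w t,
      forall t, 0 < t -> cvg (w s @[s --> t^'-]) &
      forall t, t < 0 -> w t = w 0].

Record skorokhod := Skorokhod { path_of :> R -> V; path_cadlag : cadlag path_of }.

Lemma cadlag_cst (x : V) : cadlag (fun _ => x).
Proof. by split => // t _; [exact: cvg_cst | exact: is_cvg_cst]. Qed.

HB.instance Definition _ := gen_eqMixin skorokhod.
HB.instance Definition _ := gen_choiceMixin skorokhod.
HB.instance Definition _ := isPointed.Build skorokhod (Skorokhod (cadlag_cst 0)).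

Definition time_change (lam : R -> R) :=
  (forall s t, 0 <= s -> s < t -> lam s < lam t) /\
  lam @` [set t | 0 <= t] = [set t | 0 <= t].

Definition J1_nbhd (T eps : R) (w : skorokhod) : set skorokhod :=
  [set v | exists2 lam, time_change lam &
    forall t, 0 <= t <= T -> `|lam t - t| < eps /\ `|v t - w (lam t)| < eps].

(* Skorokhod's J1 topology: by Ethier-Kurtz, Markov Processes, Prop. 3.5.3, the
   sets J1_nbhd T eps w form a (not necessarily open) base of neighbourhoods
   of w for the Skorokhod metric. *)
Definition J1_open (U : set skorokhod) :=
  forall w, U w -> exists T eps : R, 0 < eps /\ J1_nbhd T eps w `<=` U.

HB.instance Definition _ :=
  Measurable.copy skorokhod (g_sigma_algebraType J1_open).

Definition natural_filtration (t : R) : set (set skorokhod) :=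
  <<s [set C | exists s : R, 0 <= s <= t /\
        exists2 B : set V, measurable B & C = [set w : skorokhod | B (w s)]] >>.

Lemma cadlag_shift (s : R) (w : skorokhod) :
  cadlag (fun t => w (Num.max 0 s + Num.max 0 t)).
Proof.
have s0 : 0 <= Num.max 0 s by rewrite le_max lexx.
set r := Num.max 0 s in s0 *; case: (path_cadlag w) => wr wl _; split.
- move=> t t0; rewrite (max_r t0).
  apply: (@cvg_trans _ ((w u @[u --> (r + t)^'+]) : set_system V)); last first.
    by apply: wr; exact: addr_ge0.
  move=> A [e /= e0 wA]; exists e => //= u tu ltu.
  rewrite (max_r (le_trans t0 (ltW ltu))); apply: wA => /=; last by rewrite ltrD2l.
  by rewrite opprD addrACA subrr add0r.
- move=> t t0; apply: (@cvgP _ _ (lim (w u @[u --> (r + t)^'-]))).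
  apply: (@cvg_trans _ ((w u @[u --> (r + t)^'-]) : set_system V)); last first.
    by apply: wl; exact: ltr_wpDl.
  move=> A [e /= e0 wA]; exists (Num.min e t) => /=; first by rewrite lt_min e0.
  move=> u /=; rewrite lt_min => /andP[tue tut] ltu.
  have u0 : 0 <= u.
    by move: tut; rewrite gtr0_norm ?subr_gt0// ltrBlDr ltrDl => /ltW.
  rewrite (max_r u0); apply: wA => /=; last by rewrite ltrD2l.
  by rewrite opprD addrACA subrr add0r.
- by move=> t t0; rewrite (max_l (ltW t0)) maxxx.
Qed.

(* [path_shift s w] is the path t |-> w (s + t) for s >= 0 (junk if s < 0). *)
Definition path_shift (s : R) (w : skorokhod) : skorokhod :=
  Skorokhod (cadlag_shift s w).

(* The debut of ~` D is in general only universally measurable on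
   [skorokhod]; the integrals below agree with the integrals with respect to
   the completed measure. *)
Definition exit_time (D : set V) (w : skorokhod) : \bar R :=
  ereal_inf [set t%:E | t in [set t : R | 0 < t /\ ~ D (w t)]].

(* exit_time D w /\ t, a real number for 0 <= t *)
Definition exit_time_min (D : set V) (t : R) (w : skorokhod) : R :=
  fine (Order.min (exit_time D w) t%:E).

Definition martingale (Pr : {measure set skorokhod -> \bar R})
    (F : R -> set (set skorokhod)) (M : R -> skorokhod -> R) :=
  [/\ forall t, 0 <= t -> forall B : set R, measurable B -> F t (M t @^-1` B),
      forall t, 0 <= t -> Pr.-integrable setT (EFin \o M t) &
      forall s t, 0 <= s <= t -> forall A, F s A ->
        (\int[Pr]_(w in A) (M t w)%:E = \int[Pr]_(w in A) (M s w)%:E)%E].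

Definition stopping_time (F : R -> set (set skorokhod)) (T : skorokhod -> \bar R) :=
  (forall w, (0 <= T w)%E) /\
  forall t, 0 <= t -> F t [set w | (T w <= t%:E)%E].

Definition stopped_sigma_algebra (F : R -> set (set skorokhod))
    (T : skorokhod -> \bar R) : set (set skorokhod) :=
  [set A | measurable A /\
    forall t, 0 <= t -> F t (A `&` [set w | (T w <= t%:E)%E])].

End skorokhod_space.

Arguments natural_filtration {R d} t.

Section martingale_problem.
Variables (R : realType) (d : nat).
Local Notation V := 'rV[R]_d.
Local Notation Omega := (skorokhod R d).
Variables (Q : V -> 'M[R]_d) (b : V -> V) (N : R.-ker V ~> V).

Definition martingale_property (Pr : {measure set Omega -> \bar R}) :=
  forall f : V -> R, Cb2 f ->
    martingale Pr natural_filtration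
      (fun t w => f (w t) - f (w 0) -
         \int[@lebesgue_measure R]_(r in `[0, t]) levy_op Q b N f (w r)).

Definition strong_markov (P : R.-pker V ~> Omega) :=
  forall (x : V) (T : Omega -> \bar R) (A C : set Omega),
    stopping_time natural_filtration T ->
    stopped_sigma_algebra natural_filtration T A -> measurable C ->
    (P x (A `&` [set w | T w < +oo] `&` [set w | C (path_shift (fine (T w)) w)]) =
     \int[P x]_(w in A `&` [set w | T w < +oo]) P (w (fine (T w))) C)%E.

(* Measurability of x |-> P x C is part of the structure of a kernel. *)
Definition strong_markov_solution (P : R.-pker V ~> Omega) :=
  [/\ forall x, P x [set w : Omega | w 0 = x] = 1%E,
      forall x, martingale_property (P x),
      strong_markov P &
      forall (mu : probability V R) (Pmu : probability Omega R),
        (forall C, measurable C -> Pmu C = (\int[mu]_x P x C)%E) ->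
        (forall B : set V, measurable B -> Pmu [set w | B (w 0)] = mu B) /\
        martingale_property Pmu].

End martingale_problem.

Section subsolution.
Variables (R : realType) (d : nat).
Local Notation V := 'rV[R]_d.
Local Notation Omega := (skorokhod R d).
Variables (P : R.-pker V ~> Omega) (D : set V).

Definition exits_as := forall x, D x -> {ae P x, forall w, (exit_time D w < +oo)%E}.

Definition killed_semigroup (t : R) (f : V -> R) (x : V) : \bar R :=
  (\int[P x]_(w in [set w | t%:E < exit_time D w]) (f (w t))%:E)%E.

Definition principal_pair (m : set V -> \bar R) (lambda : R) (phi : V -> R) :=
  [/\ 0 <= lambda,
      measurable_fun D phi /\ forall x, D x -> 0 <= phi x,
      (0 < \int[m]_(x in D) (phi x)%:E)%E &
      forall t x, 0 <= t -> D x ->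
        killed_semigroup t phi x = (expR (- lambda * t) * phi x)%:E].

Variables (c g : V -> R).

(* c and g only matter on D: time integrals run over half-open intervals so
   that, up to the exit time, only their values on D are used. *)
Definition exp_c (t : R) (w : Omega) : R :=
  expR (- \int[@lebesgue_measure R]_(r in `[0, t[) c (w r)).

(* g may be unbounded below, hence the extended-real integrals. *)
Definition weak_subsolution (u : V -> R) :=
  bounded_borel u /\
  forall x t, D x -> 0 <= t ->
    ((u x)%:E <=
      \int[P x]_w (exp_c (exit_time_min D t w) w *
                   u (w (exit_time_min D t w)))%:E +
      \int[P x]_w \int[@lebesgue_measure R]_(r in `[0%R, exit_time_min D t w[)
                   (exp_c r w * g (w r))%:E)%E.

Definition Uplus (N : R.-ker V ~> V) (u : V -> R) :=
  weak_subsolution u /\ 0 <= sup (u @` closure_S N D).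

End subsolution.

Section lower_bound.
Variables (R : realType) (d : nat).
Local Notation V := 'rV[R]_d.

Definition hopf_rhs (D : set V) (lambda : R) (phi c g : V -> R) (ubar : R)
    (x : V) : R :=
  if `[< has_ubound (phi @` D) >] then
    phi x / (2 * expR 1 * sup (phi @` D)) *
    (inf (c @` D) * ubar / (lambda + inf (c @` D)) +
     inf ((fun y => Num.max (- g y) 0) @` D) / (lambda + sup (c @` D)))
  else 0.

End lower_bound.

(* Main.v *)
Require Import Defs.
From HB Require Import structures.
From mathcomp Require Import all_boot all_order all_algebra.
From mathcomp Require Import all_classical all_reals all_analysis.
From mathcomp Require Import measurable_realfun.
From mathcomp Require Import ring lra.
Set Implicit Arguments.
Unset Strict Implicit.
Unset Printing Implicit Defensive.
Import Order.TTheory GRing.Theory Num.Theory.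
Import numFieldTopology.Exports numFieldNormedType.Exports.
Local Open Scope classical_set_scope.
Local Open Scope ring_scope.

(* Let tau be the exit time from D. The eigenfunction gives
   P_x(tau > s) >= exp(- lambda s) phi(x) / ||phi||. If u(X_(tau /\ t)) is almost
   surely at most ubar, the subsolution inequality yields
   ubar - u(x) >= ubar (1 - exp(- cinf s1)) P_x(tau > s1)
                  + gam s2 exp(- csup s2) P_x(tau > s2),
   and s1 = 1 / (lambda + cinf), s2 = 1 / (lambda + csup) give the claim. Since the
   exit time need not be measurable, survival is replaced by a measurable minorant
   of half its mass: this is where the factor 2 is spent.

   That X cannot leave D by a jump into B = {u > ubar} follows from the martingale
   problem. Let f in C_b^2 be nonnegative and vanish on D, so that Af(x) is the
   integral of f(x + y) N(x, dy) on D. On a grid of mesh h, let A_k be the event that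
   the path is in D at time t_k and has spent no time outside D before. Summing the
   martingale property over the grid,
   E sum_k 1_(A_k) f(X_(t_(k+1))) <= E int_0^T 1_D(X_r) Af(X_r) dr + C h.
   A path leaving D by a jump to a point where f >= 1/2 makes the left-hand sum at
   least 1/2 for small h. Choosing f increasing to the indicator of an open set O
   containing B, with small mass for the compensator of the jumps out of D (a finite
   measure that does not charge B, after cutting off small jumps), and letting h tend
   to 0 shows that such paths form a null set. *)

(** * Borel structure of row vectors and of the path space *)

(** The event of staying in D throughout [0, t_k] is an uncountable intersection with no evident
    place in the natural filtration. Asking only for the position at t_k and for zero Lebesgue time
    outside gives an adapted event, at the price of the error C h. The constant C bounds |Af| and
    may blow up as f sharpens towards the indicator of O, so the mesh has to be chosen after f.
    Cutting off small jumps loses nothing: the boundary of D belongs to the extended closure, so B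
    misses the closure of D and splits into countably many pieces at positive distance from D. The
    compensator does not charge B because x + supp N(x) lies in the extended closure for x in D, and
    the complement of a support is null. The number e comes from s = 1 / (lambda + a), which
    maximises s exp(- (lambda + a) s) with value 1 / (e (lambda + a)); the term in cinf uses the
    same s together with exp(p) >= 1 + p. *)

Section row_vectors.
Variables (R : realType) (d : nat).
Local Notation V := 'rV[R]_d.

Definition box (a b : V) : set V := [set x | forall i, a 0 i < x 0 i < b 0 i].

(** Rational boxes form a base indexed by a countable type. Coordinatewise measurability, smooth
    approximation of open sets and the nullity of the complement of a support all reduce to
    countably many sets through it. *)
Lemma open_box (O : set V) (x : V) : open O -> O x ->
  exists ab : 'rV[rat]_d * 'rV[rat]_d,
    box (map_mx ratr ab.1) (map_mx ratr ab.2) x /\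
    box (map_mx ratr ab.1) (map_mx ratr ab.2) `<=` O.
Proof.
move=> oO Ox; have [e /= e0 xeO] := (nbhs_ballP _ _).1 (open_nbhs_nbhs (conj oO Ox)).
have /choice[a aP] (i : 'I_d) : exists q : rat, ratr q \in `]x 0 i - e, x 0 i[.
  by apply: rat_in_itvoo; rewrite ltrBlDr ltrDl.
have /choice[b bP] (i : 'I_d) : exists q : rat, ratr q \in `]x 0 i, x 0 i + e[.
  by apply: rat_in_itvoo; rewrite ltrDl.
exists (\row_i a i, \row_i b i); split => /= [i|y yab].
  by rewrite !mxE; have := aP i; have := bP i; rewrite !in_itv/= => /andP[-> _] /andP[_ ->].
apply: xeO; split => // i j; rewrite ord1.
have := yab j; rewrite !mxE => /andP[aj jb].
have := aP j; have := bP j; rewrite !in_itv/= => /andP[xb bx] /andP[xa ax].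
rewrite /ball /= ltr_distlC.
by rewrite (lt_trans xa aj) (lt_trans jb bx).
Qed.

Lemma measurable_open (O : set V) : open O -> measurable O.
Proof. by move=> oO; exact: sub_sigma_algebra. Qed.

Lemma measurable_closed (F : set V) : closed F -> measurable F.
Proof.
by move=> cF; rewrite -(setCK F); apply: measurableC; apply: measurable_open; rewrite openC.
Qed.

Lemma measurable_row1 (x : V) : measurable [set x].
Proof.
apply: measurable_closed; apply: accessible_closed_set1.
exact/hausdorff_accessible/norm_hausdorff.
Qed.

Lemma continuous_measurable (f : V -> R) : continuous f -> measurable_fun setT f.
Proof.
move=> cf; apply: (measurability _ (RGenOpens.measurableE R)) => //.
move=> _ [_ [a [b ->]] <-]; rewrite setTI; apply: measurable_open.
by apply: open_comp => //= x _; exact: cf.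
Qed.

Lemma measurable_coord (i : 'I_d) : measurable_fun setT (fun x : V => x 0 i).
Proof. by apply: continuous_measurable; exact: coord_continuous. Qed.

(** An open set is the countable union of the rational boxes inside it, and the preimage of a box is
    a finite intersection of coordinate conditions. *)
Lemma measurable_rowP {e} {T : measurableType e} (f : T -> V) :
  (forall i, measurable_fun setT (fun t => f t 0 i)) -> measurable_fun setT f.
Proof.
move=> mf; apply: (@measurability _ _ _ _ _ _ (@open V)) => //.
move=> _ [G oG <-]; rewrite setTI.
pose good (ab : 'rV[rat]_d * 'rV[rat]_d) :=
  box (map_mx ratr ab.1) (map_mx ratr ab.2) `<=` G.
rewrite [X in measurable X](_ : _ = \bigcup_(ab in good)
    f @^-1` box (map_mx ratr ab.1) (map_mx ratr ab.2)); last first.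
  apply/seteqP; split => [t /= Gft|t [ab gab /= ft]]; last exact: gab.
  by have [ab [? ?]] := open_box oG Gft; exists ab.
rewrite bigcup_mkcond; apply: countable_bigcupT_measurable => // ab.
case: ifP => // _.
rewrite [X in measurable X](_ : _ = \bigcap_(i in [set: 'I_d])
   [set t | (map_mx ratr ab.1 : V) 0 i < f t 0 i < (map_mx ratr ab.2 : V) 0 i]); last first.
  by apply/seteqP; split => t /= h; [move=> i _; exact: h|move=> i; exact: h].
apply: fin_bigcap_measurable; first exact: finite_finset.
move=> i _.
rewrite [X in measurable X](_ : _ = (fun t => f t 0 i) @^-1`
   `](map_mx ratr ab.1 : V) 0 i, (map_mx ratr ab.2 : V) 0 i[%classic); last first.
  by apply/seteqP; split => t /=; rewrite in_itv.
by rewrite -[X in measurable X]setTI; apply: mf => //; exact: measurable_itv.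
Qed.

Lemma coord_le_norm (x : V) i : `|x 0 i| <= `|x|.
Proof.
rewrite [leRHS]mx_normrE.
exact: (le_bigmax _ (fun ij : 'I_1 * 'I_d => `|x ij.1 ij.2|) (0, i)).
Qed.

End row_vectors.

(** * Joint measurability of right-continuous processes *)

Section joint_measurability.
Variables (R : realType) (d : nat).
Local Notation V := 'rV[R]_d.

Definition right_continuous (w : R -> V) := forall s e, 0 < e ->
  exists2 del, 0 < del & forall r, s <= r < s + del -> `|w r - w s| < e.

(** The first point strictly after [s] on the grid of mesh 1/(n+1). Times are rounded up because
    right-continuity only controls an approach from the right. *)
Definition next_grid (n : nat) (s : R) : R :=
  ((Num.floor (s * n.+1%:R))%:~R + 1) / n.+1%:R.

Lemma next_grid_itv n s : s < next_grid n s <= s + n.+1%:R^-1.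
Proof.
have n0 : 0 < n.+1%:R :> R by [].
rewrite /next_grid ltr_pdivlMr// ler_pdivrMr// mulrDl mulVf ?gt_eqF// lerD2r.
have /andP[h1 h2] := floor_itv (s * n.+1%:R).
by rewrite h1 andbT -[1](rmorph1 intr) -intrD.
Qed.

(** The rounded time depends on the time only through an integer floor [k], so a preimage is a
    countable union of rectangles, one for each [k]. *)
Lemma measurable_next_grid n e (T : measurableType e) (X : T -> R -> R) :
  (forall s, measurable_fun setT (X ^~ s)) ->
  measurable_fun setT (fun z : T * R => X z.1 (next_grid n z.2)).
Proof.
move=> mX _ B mB; rewrite setTI.
pose G k : set (T * R) :=
  ((X ^~ ((k%:~R + 1) / n.+1%:R)) @^-1` B) `*`
  [set s : R | k%:~R <= s * n.+1%:R < (k + 1)%:~R].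
rewrite [X in measurable X](_ : _ = \bigcup_(k in [set: int]) G k); last first.
  apply/seteqP; split => [[t s] /= Bts|[t s] [k _ [/= Bt ks]]].
    exists (Num.floor (s * n.+1%:R)) => //; split => //=.
    exact: floor_itv.
  suff -> : next_grid n s = (k%:~R + 1) / n.+1%:R by [].
  by rewrite /next_grid (floor_def ks).
apply: countable_bigcupT_measurable => // k.
apply: measurableX; first by rewrite -[X in measurable X]setTI; exact: mX.
rewrite [X in measurable X](_ : _ = (fun s : R => s * n.+1%:R) @^-1`
   `[k%:~R, (k + 1)%:~R[%classic); last first.
  by apply/seteqP; split => t /=; rewrite in_itv.
by rewrite -[X in measurable X]setTI; exact: mulrr_measurable.
Qed.

Lemma next_grid_cvg (w : R -> V) s i : right_continuous w ->
  w (next_grid n s) 0 i @[n --> \oo] --> w s 0 i.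
Proof.
move=> wr; apply/cvgrPdist_lt => e e0.
have [del del0 wdel] := wr s e e0.
near=> n.
have /andP[h1 h2] := next_grid_itv n s.
have : `|w (next_grid n s) - w s| < e.
  apply: wdel; rewrite (ltW h1) (le_lt_trans h2)// ltrD2l.
  by near: n; exact: near_infty_natSinv_lt (PosNum del0).
apply: le_lt_trans; rewrite distrC.
have -> : w (next_grid n s) 0 i - w s 0 i = (w (next_grid n s) - w s) 0 i.
  by rewrite !mxE.
exact: coord_le_norm.
Unshelve. all: by end_near. Qed.

Lemma measurable_right_continuous e (T : measurableType e) (X : T -> R -> V) :
  (forall s, measurable_fun setT (X ^~ s)) ->
  (forall t, right_continuous (X t)) ->
  measurable_fun setT (fun z : T * R => X z.1 z.2).
Proof.
move=> mX cX; apply: measurable_rowP => i.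
apply: (@measurable_fun_cvg _ _ _ _
   (fun n (z : T * R) => X z.1 (next_grid n z.2) 0 i)).
  move=> n; apply: (@measurable_next_grid n _ _ (fun t s => X t s 0 i)) => s.
  exact: (measurableT_comp (@measurable_coord R d i) (mX s)).
by move=> [t s] _ /=; exact: next_grid_cvg.
Qed.

End joint_measurability.

(** * Evaluations and occupation times on the Skorokhod space *)

Section evaluation.
Variables (R : realType) (d : nat).
Local Notation V := 'rV[R]_d.
Local Notation Omega := (skorokhod R d).

Lemma path_right (w : Omega) (s e : R) : 0 <= s -> 0 < e ->
  exists2 del, 0 < del & forall r, s <= r < s + del -> `|w r - w s| < e.
Proof.
move=> s0 e0; have [/(_ s s0) + _ _] := path_cadlag w.
move=> /cvgrPdist_lt/(_ e e0)[del /= del0 h]; exists del => // r /andP[].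
rewrite le_eqVlt => /orP[/eqP <- _|sr rs]; first by rewrite subrr normr0.
rewrite distrC; apply: h => //=.
by rewrite ltr_distlC ltrBlDr (lt_trans sr) ?ltrDl//= rs.
Qed.

(** Evaluation at a fixed time is not J1-continuous, but a visit to an open set during an open time
    interval survives a small time change combined with a small displacement. These open sets link
    the J1 topology to evaluations. *)
Lemma J1_open_visit (a b : R) (G : set V) : 0 <= a -> open G ->
  J1_open [set w : Omega | exists2 r, a < r < b & G (w r)].
Proof.
move=> a0 oG w [r /andP[ar rb] Gwr].
have [e /= e0 eG] := (nbhs_normP _ _).1 (open_nbhs_nbhs (conj oG Gwr)).
pose eps := Num.min e (Num.min (r - a) (b - r)).
have eps0 : 0 < eps by rewrite !lt_min e0 !subr_gt0 ar rb.
exists (r + eps), eps; split => // v [lam [lamI lamS] h].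
have r0 : 0 <= r by rewrite (le_trans a0) ?ltW.
have [t /= t0 tr] : (lam @` [set t | 0 <= t]) r by rewrite lamS.
(* Closeness of [v] and [w] is known only up to the horizon [r + eps]. A later [t] would give
   [lam (r + eps) < r], which moves [r + eps] by more than [eps]. *)
have tT : t <= r + eps.
  rewrite leNgt; apply/negP => /(lamI _ t _)-/(_ (addr_ge0 r0 (ltW eps0))).
  rewrite tr => lt_r; have [] := h (r + eps).
    by rewrite lexx addr_ge0// ltW.
  by rewrite ltr_norml => /andP[+ _] _; lra.
have [] := h t; first by rewrite t0.
rewrite tr !lt_min => /and3P[_ h1 h2] /andP[h3 _].
exists t; last by apply: eG; rewrite /ball_/= distrC.
move: h1 h2; rewrite !ltr_norml => /andP[h1 h1'] /andP[h2 h2'].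
by apply/andP; split; lra.
Qed.

Lemma path_right_continuous (w : Omega) : right_continuous w.
Proof.
move=> s e e0; have [s0|s0] := leP 0 s; first exact: path_right.
exists (- s); first by rewrite oppr_gt0.
move=> r; rewrite subrr => /andP[_ r0]; have [_ _ w0] := path_cadlag w.
by rewrite (w0 _ r0) (w0 _ s0) subrr normr0.
Qed.

Lemma right_continuous_min (w : R -> V) t :
  right_continuous w -> right_continuous (fun s => w (Num.min s t)).
Proof.
move=> wr s e e0; have [ts|st] := leP t s.
  exists 1 => // r /andP[sr _]; rewrite !min_r ?subrr ?normr0//.
  exact: le_trans sr.
have [del del0 wdel] := wr s e e0.
exists (Num.min del (t - s)); first by rewrite lt_min del0 subr_gt0.
move=> r /andP[sr]; rewrite addr_minr lt_min => /andP[rd rt].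
rewrite /= min_l; last by lra.
by apply: wdel; rewrite sr.
Qed.

(* [w s] lies in the open set [G] iff, for some [m] and [n], the path avoids the
   open set [F m] of points within 1/(m+1) of the complement of [G] on a right
   neighbourhood of [s] of length 1/(n+1). *)
Lemma measurable_eval (s : R) : measurable_fun setT (fun w : Omega => w s).
Proof.
wlog s0 : s / 0 <= s.
  move=> h; have [s0|s0] := leP 0 s; first exact: h.
  rewrite (_ : (fun w : Omega => w s) = (fun w => w 0)); first exact: h.
  by apply/funext => w; have [_ _ ->] := path_cadlag w.
apply: (@measurability _ _ _ _ _ _ (@open V)) => //.
move=> _ [G oG <-]; rewrite setTI.
pose F (m : nat) : set V :=
  [set x | exists2 y, ~ G y & `|x - y| < m.+1%:R^-1].
have oF m : open (F m).
  rewrite (_ : F m = \bigcup_(y in ~` G) ball y m.+1%:R^-1).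
    by apply: bigcup_open => y _; exact: ball_open.
  by apply/seteqP; split => [x [y Gy xy]|x [y Gy xy]]; exists y => //;
    move: xy; rewrite -ball_normE /ball_/= distrC.
pose Vis m n := [set w : Omega | exists2 r, s < r < s + n.+1%:R^-1 & F m (w r)].
rewrite [X in measurable X](_ : _ = \bigcup_m \bigcup_n ~` Vis m n).
  apply: bigcupT_measurable => m; apply: bigcupT_measurable => n.
  by apply: measurableC; apply: sub_sigma_algebra; exact: J1_open_visit.
apply/seteqP; split => [w /= Gws|w [m _ [n _ /= nVis]]].
  have [e /= e0 eG] := (nbhs_normP _ _).1 (open_nbhs_nbhs (conj oG Gws)).
  have e20 : 0 < e / 2 by rewrite divr_gt0.
  have [del del0 wdel] := path_right w s0 e20.
  have [m _ /(_ _ (leqnn m)) me] := near_infty_natSinv_lt (PosNum e20).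
  have [n _ /(_ _ (leqnn n)) nd] := near_infty_natSinv_lt (PosNum del0).
  exists m => //; exists n => // -[r /andP[sr rn] [y Gy wry]]; apply: Gy.
  apply: eG; rewrite /ball_/=.
  have := wdel r; rewrite (ltW sr) (lt_trans rn) ?ltrD2l// => /(_ isT) wrs.
  have -> : w s - y = - (w r - w s) + (w r - y) by rewrite opprB addrA subrK.
  rewrite (le_lt_trans (ler_normD _ _))// normrN (splitr e) ltrD//.
  exact: lt_trans me.
apply: contrapT => Gws; apply: nVis.
have [del del0 wdel] := path_right w s0 (e := m.+1%:R^-1) ltac:(by []).
pose k := Num.min del n.+1%:R^-1 / 2.
have k0 : 0 < k by rewrite divr_gt0// lt_min del0/=.
have k2 : k < Num.min del n.+1%:R^-1.
  by rewrite /k ltr_pdivrMr// mulr_natr mulr2n ltrDl lt_min del0/=.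
move: k2; rewrite lt_min => /andP[kd kn].
exists (s + k); first by rewrite ltrDl k0 ltrD2l.
by exists (w s) => //; apply: wdel; rewrite lerDl ltW//= ltrD2l.
Qed.

Lemma natural_filtration_measurable (t : R) :
  (natural_filtration t : set (set Omega)) `<=` measurable.
Proof.
apply: smallest_sub; first exact: sigma_algebra_measurable.
move=> _ [s [_ [B mB ->]]].
by rewrite -[X in measurable X]setTI; exact: measurable_eval.
Qed.

Lemma measurable_path :
  measurable_fun setT (fun z : Omega * R => z.1 z.2).
Proof.
apply: (measurable_right_continuous (X := fun w : Omega => w)).
  exact: measurable_eval.
exact: path_right_continuous.
Qed.

(** Measured by Lebesgue time so that Fubini yields adaptedness. A path that stays in [D] before [t]
    has value 0; the value 0 still allows visits to the complement of [D] on a null set of times. *)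
Definition time_outside (D : set V) (t : R) (w : Omega) : \bar R :=
  lebesgue_measure [set s : R | 0 <= s <= t /\ ~ D (w s)].

Lemma measurable_time_outside_section (D : set V) (t : R) (w : Omega) :
  measurable D -> measurable [set s : R | 0 <= s <= t /\ ~ D (w s)].
Proof.
move=> mD; rewrite (_ : [set s | _] = `[0, t] `&` (fun s : R => w s) @^-1` (~` D)).
  apply: measurableI => //; rewrite -[X in measurable X]setTI.
  have := measurableT_comp measurable_path (pair1_measurable w).
  by apply => //; exact: measurableC.
by apply/seteqP; split => s /=; rewrite in_itv.
Qed.

(* The path stopped at [t] is jointly measurable for the sigma-algebra at time
   [t], whence the adaptedness of occupation times. *)
Lemma natural_filtration_time_outside (D : set V) (t : R) : 0 <= t ->
  measurable D ->
  natural_filtration t [set w : Omega | time_outside D t w = 0%E].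
Proof.
move=> t0 mD; rewrite /natural_filtration.
set G := [set C | _].
pose X (w : g_sigma_algebraType G) (s : R) : V := (w : Omega) (Num.min s t).
have mX : measurable_fun setT (fun z : g_sigma_algebraType G * R => X z.1 z.2).
  apply: measurable_right_continuous => [s|w]; last first.
    exact/right_continuous_min/path_right_continuous.
  move=> _ B mB; rewrite setTI; apply: sub_sigma_algebra.
  exists (Num.max 0 (Num.min s t)).
  split; first by rewrite le_max lexx/= ge_max t0 ge_min lexx orbT.
  exists B => //; suff E w : X w s = (w : Omega) (Num.max 0 (Num.min s t)).
    by apply/seteqP; split => w /=; rewrite E.
  rewrite /X; have [//|s0] := leP 0 (Num.min s t).
  by have [_ _ /(_ _ s0)] := path_cadlag (w : Omega).
pose S := (setT `*` `[0, t]%classic) `&`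
  (fun z : g_sigma_algebraType G * R => X z.1 z.2) @^-1` (~` D).
have mS : measurable S.
  apply: measurableI; first exact: measurableX.
  by rewrite -[X in measurable X]setTI; apply: mX => //; exact: measurableC.
have : measurable_fun setT ((@lebesgue_measure R) \o xsection S).
  exact: measurable_fun_xsection.
move=> /(_ measurableT [set 0%E]) /(_ (emeasurable_set1 _)); rewrite setTI.
suff <- : [set w | time_outside D t w = 0%E] =
  ((@lebesgue_measure R) \o xsection S) @^-1` [set 0%E] by [].
suff E (w : Omega) : [set s : R | 0 <= s <= t /\ ~ D (w s)] = xsection S w.
  by apply/seteqP; split => w /=; rewrite /time_outside E.
apply/seteqP; split => s /=; rewrite /xsection /= inE /S /= in_itv /= /X.
  by move=> [/andP[s0 st] Ds]; rewrite s0 st (min_l st).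
by move=> [[_ /andP[s0 st]]]; rewrite s0 st (min_l st).
Qed.

End evaluation.

(** * Test functions *)

Section Cb2_functions.
Variables (R : realType) (d : nat).
Local Notation V := 'rV[R]_d.
Implicit Types f g : V -> R.

Definition Cb1 f := Cb f /\
  forall i, (forall x, derivable f x (delta_mx 0 i)) /\ Cb (pderiv i f).

(** Closure of [Cb2] under sums and products reduces to closure of [Cb1], used for the function and
    again for its partial derivatives. *)
Lemma Cb2P f : Cb2 f <-> Cb1 f /\ forall j, Cb1 (pderiv j f).
Proof.
split=> [[f0 f1 f2]|[[f0 f1] f2]].
  by split=> // j; split => [|i]; [exact: (f1 j).2|exact: f2].
by split => // i j; exact: (f2 j).2.
Qed.

Lemma Cb_cst (k : R) : Cb (cst k : V -> R).
Proof. by split; [exact: cst_continuous|exists `|k|]. Qed.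

Lemma CbD f g : Cb f -> Cb g -> Cb (f + g).
Proof.
move=> [cf [K fK]] [cg [L gL]]; split; first by move=> x; exact: (continuousD (cf x) (cg x)).
exists (K + L) => x _; rewrite (le_trans (ler_normD _ _))// lerD//; [exact: fK|exact: gL].
Qed.

Lemma CbM f g : Cb f -> Cb g -> Cb (f * g).
Proof.
move=> [cf [K fK]] [cg [L gL]]; split; first by move=> x; exact: (continuousM (cf x) (cg x)).
exists (K * L) => x _; rewrite normrM ler_pM//; [exact: fK|exact: gL].
Qed.

Lemma Cb1_cst (k : R) : Cb1 (cst k : V -> R).
Proof.
split; first exact: Cb_cst.
move=> i; split => [x|]; first exact: derivable_cst.
rewrite (_ : pderiv i _ = cst 0); first exact: Cb_cst.
by apply/funext => x; exact: derive_cst.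
Qed.

Lemma pderivD i f g : (forall x, derivable f x (delta_mx 0 i)) ->
  (forall x, derivable g x (delta_mx 0 i)) ->
  pderiv i (f + g) = pderiv i f + pderiv i g.
Proof. by move=> df dg; apply/funext => x; exact: deriveD. Qed.

Lemma pderivM i f g : (forall x, derivable f x (delta_mx 0 i)) ->
  (forall x, derivable g x (delta_mx 0 i)) ->
  pderiv i (f * g) = f * pderiv i g + g * pderiv i f.
Proof. by move=> df dg; apply/funext => x; exact: deriveM. Qed.

Lemma Cb1D f g : Cb1 f -> Cb1 g -> Cb1 (f + g).
Proof.
move=> [f0 f1] [g0 g1]; split; first exact: CbD.
move=> i; have [df cf] := f1 i; have [dg cg] := g1 i.
by split => [x|]; [exact: derivableD|rewrite pderivD//; exact: CbD].
Qed.

Lemma Cb1M f g : Cb1 f -> Cb1 g -> Cb1 (f * g).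
Proof.
move=> [f0 f1] [g0 g1]; split; first exact: CbM.
move=> i; have [df cf] := f1 i; have [dg cg] := g1 i.
split => [x|]; first exact: derivableM.
by rewrite pderivM//; apply: CbD; exact: CbM.
Qed.

Lemma Cb2_cst (k : R) : Cb2 (cst k : V -> R).
Proof.
apply/Cb2P; split; first exact: Cb1_cst.
move=> j; rewrite (_ : pderiv j _ = cst 0); first exact: Cb1_cst.
by apply/funext => x; exact: derive_cst.
Qed.

Lemma Cb2D f g : Cb2 f -> Cb2 g -> Cb2 (f + g).
Proof.
move=> /Cb2P[f1 f2] /Cb2P[g1 g2]; apply/Cb2P; split; first exact: Cb1D.
move=> j; rewrite pderivD; [exact: Cb1D|exact: (f1.2 j).1|exact: (g1.2 j).1].
Qed.

Lemma Cb2M f g : Cb2 f -> Cb2 g -> Cb2 (f * g).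
Proof.
move=> /Cb2P[f1 f2] /Cb2P[g1 g2]; apply/Cb2P; split; first exact: Cb1M.
move=> j; rewrite pderivM; [|exact: (f1.2 j).1|exact: (g1.2 j).1].
by apply: Cb1D; exact: Cb1M.
Qed.

Lemma Cb2N f : Cb2 f -> Cb2 (- f).
Proof.
move=> f2; rewrite (_ : - f = cst (-1) * f); first exact: (Cb2M (Cb2_cst _)).
by apply/funext => x /=; rewrite -[RHS]/(-1 * f x) mulN1r.
Qed.

Lemma Cb2_prod (I : Type) (r : seq I) (F : I -> V -> R) :
  (forall i, Cb2 (F i)) -> Cb2 (fun x => \prod_(i <- r) F i x).
Proof.
move=> F2; elim: r => [|i r IH].
  rewrite (_ : (fun x => _) = cst 1); first exact: Cb2_cst.
  by apply/funext => x; rewrite big_nil.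
rewrite (_ : (fun x => _) = F i * (fun x => \prod_(i <- r) F i x)).
  exact: Cb2M.
by apply/funext => x; rewrite big_cons.
Qed.

Lemma is_derive_coord (i j : 'I_d) (g g' : R -> R) (x : V) :
  (forall s : R, is_derive s 1 g (g' s)) ->
  is_derive x (delta_mx 0 j) (fun x => g (x 0 i)) ((i == j)%:R * g' (x 0 i)).
Proof.
move=> dg.
have E : is_derive (x 0 i) ((i == j)%:R : R) g ((i == j)%:R * g' (x 0 i)).
  by case: eqP => _; rewrite ?mul1r ?mul0r//; exact: is_derive0.
have Eq : (fun h : R => h^-1 *: (((fun x : V => g (x 0 i)) \o shift x)
      (h *: delta_mx 0 j) - g (x 0 i))) =
    (fun h : R => h^-1 *: ((g \o shift (x 0 i)) (h *: ((i == j)%:R : R)) - g (x 0 i))).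
  by apply/funext => h; rewrite /= !mxE eqxx.
by case: E => E1 E2; split; rewrite /derivable /derive Eq.
Qed.

Lemma Cb_coord (i : 'I_d) (g : R -> R) : continuous g -> bounded_on setT g ->
  Cb (fun x : V => g (x 0 i)).
Proof.
move=> cg [K gK]; split; last by exists K => x _; exact: gK.
by move=> x; apply: continuous_comp; [exact: coord_continuous|exact: cg].
Qed.

Lemma Cb1_coord (i : 'I_d) (g g' : R -> R) :
  (forall s : R, is_derive s 1 g (g' s)) ->
  continuous g' -> bounded_on setT g -> bounded_on setT g' ->
  Cb1 (fun x : V => g (x 0 i)).
Proof.
move=> dg cg' bg bg'; split.
  apply: Cb_coord => // s; apply: differentiable_continuous.
  by apply/derivable1_diffP; have [] := dg s.
move=> j; split => [x|]; first by have [] := is_derive_coord i j x dg.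
rewrite (_ : pderiv j _ = cst (i == j)%:R * (fun x : V => g' (x 0 i))).
  by apply: CbM; [exact: Cb_cst|exact: Cb_coord].
by apply/funext => x; rewrite /pderiv; have [_ ->] := is_derive_coord i j x dg.
Qed.

Lemma Cb2_coord (i : 'I_d) (g g' g'' : R -> R) :
  (forall s : R, is_derive s 1 g (g' s)) -> (forall s : R, is_derive s 1 g' (g'' s)) ->
  continuous g'' ->
  bounded_on setT g -> bounded_on setT g' -> bounded_on setT g'' ->
  Cb2 (fun x : V => g (x 0 i)).
Proof.
move=> dg dg' cg'' bg bg' bg''; apply/Cb2P.
have cg' : continuous g'.
  move=> s; apply: differentiable_continuous.
  by apply/derivable1_diffP; have [] := dg' s.
split; first exact: Cb1_coord.
move=> j; rewrite (_ : pderiv j _ = cst (i == j)%:R * (fun x : V => g' (x 0 i))).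
  by apply: Cb1M; [exact: Cb1_cst|exact: Cb1_coord].
by apply/funext => x; rewrite /pderiv; have [_ ->] := is_derive_coord i j x dg.
Qed.

End Cb2_functions.

(** * A compactly supported C^2 bump on the line *)

Section bump.
Variable R : realType.

Definition ppart (s : R) : R := Num.max 0 s.

Lemma ppart_continuous : continuous ppart.
Proof.
move=> s; rewrite /ppart; apply: continuous_max; [exact: cst_continuous|exact: cvg_id].
Qed.

(** The only delicate point is the kink: the difference quotient at 0 equals [ppart h ^+ n.+1],
    which tends to 0 because the exponent is at least 1. *)
Lemma is_derive_ppart n (s : R) :
  is_derive s 1 (fun s => ppart s ^+ n.+2) (n.+2%:R * ppart s ^+ n.+1).
Proof.
have [s0|s0|->] := ltgtP s 0.
- apply: (@near_eq_is_derive _ R^o R^o (cst 0)) => //.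
    near=> t; rewrite /ppart max_l ?expr0n//; apply/ltW.
    by near: t; exact: lt_nbhsl.
  by rewrite /ppart (max_l (ltW s0)) expr0n mulr0; exact: is_derive_cst.
- apply: (@near_eq_is_derive _ R^o R^o (fun t : R => t ^+ n.+2)) => //.
    near=> t; rewrite /ppart max_r//; apply/ltW.
    by near: t; exact: lt_nbhsr.
  rewrite /ppart (max_r (ltW s0)).
  by split; [exact: exprn_derivable|rewrite exp_derive -![_ *: _]/(_ * _) mulr1].
- have h : (fun h : R => h^-1 *: (((fun s => ppart s ^+ n.+2) \o shift 0)
     (h *: (1 : R)) - ppart 0 ^+ n.+2)) @ 0^' --> n.+2%:R * ppart 0 ^+ n.+1.
    have p0 : ppart 0 = 0 by rewrite /ppart maxxx.
    have -> : n.+2%:R * ppart 0 ^+ n.+1 = ppart 0 ^+ n.+1 by rewrite p0 expr0n mulr0.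
    apply: (@cvg_trans _ (ppart h ^+ n.+1 @[h --> 0^'])).
      apply: near_eq_cvg; near=> h => /=.
      have h0 : h != 0 by near: h; exact: nbhs_dnbhs_neq.
      rewrite p0 expr0n subr0 addr0 -[h *: 1]/(h * 1) mulr1 /ppart.
      have [hp|hn|he] := ltgtP 0 h; last by rewrite he eqxx in h0.
        by rewrite -[RHS]/(_ * _) [in RHS]exprS mulKf.
      by rewrite !expr0n /= scaler0.
    apply: cvg_within_filter.
    have /(_ 0) : continuous (fun h : R => ppart h ^+ n.+1).
      move=> t.
      exact: (continuous_comp (@ppart_continuous t) (@exprn_continuous _ n.+1 _)).
    exact.
  by split; [apply/cvg_ex; eexists; exact: h|exact: cvg_lim h].
Unshelve. all: by end_near. Qed.

Lemma bounded_continuous_itv (f : R -> R) a b : a < b -> continuous f ->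
  (forall s, s \notin `[a, b] -> f s = 0) -> bounded_on setT f.
Proof.
move=> ab cf f0.
have [c _ cM] := EVT_max (ltW ab) (continuous_subspaceT (cf : continuous f)).
have [e _ eM] := EVT_min (ltW ab) (continuous_subspaceT (cf : continuous f)).
exists (Num.max `|f c| `|f e|) => s _.
have [sab|sab] := boolP (s \in `[a, b]); last by rewrite f0// normr0 le_max normr_ge0.
have := cM s sab; have := eM s sab.
set M := Num.max _ _ => h1 h2.
have : `|f c| <= M by rewrite le_max lexx.
have : `|f e| <= M by rewrite le_max lexx orbT.
rewrite !ler_norml => /andP[h3 _] /andP[_ h4].
by rewrite (le_trans h3)// (le_trans h2).
Qed.

(** The witness is the cube of the positive part of the parabola (s - a)(b - s). The cube is the
    least integer power of the positive part with two continuous derivatives across the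
    endpoints. *)
Lemma ex_bump (a b : R) : a < b -> exists g g' g'' : R -> R,
  [/\ (forall s : R, is_derive s 1 g (g' s)) /\ (forall s : R, is_derive s 1 g' (g'' s)),
   continuous g'', bounded_on setT g /\ bounded_on setT g', bounded_on setT g'' &
   forall s, 0 <= g s /\ (0 < g s) = (a < s < b)].
Proof.
move=> ab.
pose q (s : R) := (s - a) * (b - s).
pose q' (s : R) := (b - s) - (s - a).
have dq (s : R) : is_derive s 1 q (q' s).
  rewrite /q; apply: is_derive_eq; rewrite /q' /=.
  by rewrite -![_ *: _]/(_ * _); ring.
have dq' (s : R) : is_derive s 1 q' (- 2).
  rewrite /q'; apply: is_derive_eq; ring.
have cq : continuous q.
  by move=> s; apply: differentiable_continuous; apply/derivable1_diffP; have [] := dq s.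
have cq' : continuous q'.
  by move=> s; apply: differentiable_continuous; apply/derivable1_diffP; have [] := dq' s.
have dp n (s : R) : is_derive s 1 (fun s => ppart (q s) ^+ n.+2)
   (n.+2%:R * ppart (q s) ^+ n.+1 * q' s).
  exact: (is_derive1_comp (is_derive_ppart n (q s)) (dq s)).
have cp : continuous (fun s => ppart (q s)).
  by move=> s; exact: (continuous_comp (cq s) (@ppart_continuous (q s))).
have cpX n : continuous (fun s => ppart (q s) ^+ n).
  by move=> s; exact: (continuous_comp (cp s) (@exprn_continuous _ n _)).
have p0 (s : R) : s \notin `[a, b] -> ppart (q s) = 0.
  rewrite in_itv/= negb_and -!ltNge => sab; rewrite /ppart max_l// /q.
  by case/orP: sab => sab; [rewrite nmulr_rle0|rewrite pmulr_rle0]; lra.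
pose g' s := 3 * ppart (q s) ^+ 2 * q' s.
pose g'' s := 3 * (ppart (q s) ^+ 2 * (-2) + q' s * (2 * ppart (q s) ^+ 1 * q' s)).
have dg' (s : R) : is_derive s 1 g' (g'' s).
  rewrite (_ : g' = 3 *: ((fun s => ppart (q s) ^+ 2) * q')).
    exact: (is_deriveZ _ (is_deriveM (dp 0 s) (dq' s))).
  by apply/funext => t; rewrite /g' -[RHS]/(3 * (ppart (q t) ^+ 2 * q' t)) mulrA.
have cg'' : continuous g''.
  move=> s; apply: cvgM; first exact: cvg_cst.
  apply: cvgD; first by apply: cvgM; [exact: cpX|exact: cvg_cst].
  apply: cvgM; first exact: cq'.
  by apply: cvgM; [apply: cvgM; [exact: cvg_cst|exact: cpX]|exact: cq'].
have cg' : continuous g'.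
  by move=> s; apply: differentiable_continuous; apply/derivable1_diffP; have [] := dg' s.
exists (fun s => ppart (q s) ^+ 3), g', g''; split => //.
- split; apply: (bounded_continuous_itv ab) => // s sab.
    by rewrite p0// expr0n.
  by rewrite /g' p0// expr0n mulr0 mul0r.
- apply: (bounded_continuous_itv ab) => // s sab.
  by rewrite /g'' p0// !expr0n /= !(mulr0, mul0r, add0r).
- move=> s; have ps : 0 <= ppart (q s) by rewrite /ppart le_max lexx.
  split; first exact: exprn_ge0.
  rewrite exprn_odd_gt0//.
  have [|sab] := boolP (s \in `[a, b]); last first.
    rewrite p0// ltxx; apply/esym; move: sab; apply: contraNF.
    by rewrite in_itv/= => /andP[/ltW -> /ltW ->].
  rewrite in_itv/= => /andP[sa sb].
  rewrite /ppart lt_max ltxx /= /q.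
  move: sa; rewrite le_eqVlt => /orP[/eqP <-|sa]; first by rewrite subrr mul0r ltxx.
  move: sb; rewrite le_eqVlt => /orP[/eqP ->|sb]; first by rewrite subrr mulr0 ltxx andbF.
  by rewrite sa sb mulr_gt0// subr_gt0.
Qed.

End bump.

(** * Approximation of indicators of open sets by test functions *)

Section smooth_approximation.
Variables (R : realType) (d : nat).
Local Notation V := 'rV[R]_d.

Lemma ex_box_bump (a b : V) : exists p : V -> R, Cb2 p /\
  forall x, 0 <= p x <= 1 /\ (0 < p x <-> box a b x).
Proof.
have [ab|nab] := pselect (forall i, a 0 i < b 0 i); last first.
  exists (cst 0); split; first exact: Cb2_cst.
  move=> x; rewrite /= lexx ler01 ltxx; split => //; split => // xab; exfalso; apply: nab => i.
  by have /andP[/lt_trans] := xab i; apply.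
have /choice[g gP] (i : 'I_d) : exists g : R -> R, Cb2 (fun x : V => g (x 0 i)) /\
    (forall s, 0 <= g s <= 1 /\ (0 < g s) = (a 0 i < s < b 0 i)).
  have [g [g' [g'' [[dg dg'] cg'' [bg bg'] bg'' gE]]]] := ex_bump (ab i).
  have [K gK] := bg.
  have K0 : 0 < `|K| + 1 by rewrite ltr_wpDl.
  exists (fun s => (`|K| + 1)^-1 * g s); split.
    have := Cb2M (Cb2_cst d (`|K| + 1)^-1) (Cb2_coord i dg dg' cg'' bg bg' bg'').
    exact.
  move=> s; have [g0 <-] := gE s; split; last by rewrite pmulr_rgt0// invr_gt0.
  rewrite mulr_ge0 ?invr_ge0 ?(ltW K0)//= ler_pdivrMl// mulr1.
  have := gK s I; rewrite ger0_norm// => /le_trans; apply.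
  by rewrite ler_wpDr// ler_norm.
exists (fun x => \prod_(i < d) g i (x 0 i)); split.
  by apply: Cb2_prod => i; exact: (gP i).1.
move=> x; split.
  apply/andP; split.
    by apply: prodr_ge0 => i _; have [/andP[]] := (gP i).2 (x 0 i).
  apply: prodr_ile1 => i _; exact: ((gP i).2 (x 0 i)).1.
split => [p0 i|xab].
  rewrite -((gP i).2 (x 0 i)).2 lt_neqAle eq_sym.
  have [/andP[-> _] _] := (gP i).2 (x 0 i); rewrite andbT.
  move: p0 => /gt_eqF/negbT/prodf_neq0; exact.
by apply: prodr_gt0 => i _; rewrite ((gP i).2 (x 0 i)).2; exact: xab.
Qed.

(** With [p i] a bump on the [i]-th rational box, or 0 if that box is not inside [O], take 1 minus
    the product over i < n of (1 - p i)^n. The lower bound 1/2 is locally uniform because the test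
    function will be evaluated at a grid time slightly after the jump, not at the landing point. *)
Lemma ex_open_approx (O : set V) : open O -> exists f : nat -> V -> R,
  [/\ forall n, Cb2 (f n), forall n x, 0 <= f n x <= 1,
      forall n x, ~ O x -> f n x = 0 &
      forall x, O x -> exists2 e : R, 0 < e & exists n0 : nat, forall n y,
        (n0 <= n)%N -> `|y - x| < e -> 2^-1 <= f n y].
Proof.
move=> oO.
have /choice[p pP] (n : nat) : exists p : V -> R,
    [/\ Cb2 p, forall x, 0 <= p x <= 1, forall x, ~ O x -> p x = 0 &
     forall ab : 'rV[rat]_d * 'rV[rat]_d, unpickle n = Some ab ->
       box (map_mx ratr ab.1) (map_mx ratr ab.2) `<=` O ->
       forall x, box (map_mx ratr ab.1) (map_mx ratr ab.2) x -> 0 < p x].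
  case: (@unpickle ('rV[rat]_d * 'rV[rat]_d)%type n) => [ab|]; last first.
    exists (cst 0); split => //; first exact: Cb2_cst.
    by move=> x; rewrite lexx ler01.
  have [abO|nabO] := pselect
    (box (map_mx ratr ab.1) (map_mx ratr ab.2) `<=` O); last first.
    exists (cst 0); split => //; first exact: Cb2_cst.
      by move=> x; rewrite lexx ler01.
    by move=> _ [<-].
  have [p [p2 pE]] := ex_box_bump (map_mx ratr ab.1) (map_mx ratr ab.2).
  exists p; split => //.
  - by move=> x; have [] := pE x.
  - move=> x nOx; apply/eqP; rewrite eq_le leNgt.
    have [/andP[-> _] [pbox _]] := pE x; rewrite andbT.
    by apply/negP => /pbox/abO.
  - by move=> _ [<-] _ x abx; apply/(pE x).2.
have p01 n x : 0 <= p n x <= 1 by have [_ ->] := pP n.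
exists (fun n => cst 1 - (fun x => \prod_(i < n) (1 - p i x) ^+ n)).
have q01 n x : 0 <= \prod_(i < n) (1 - p i x) ^+ n <= 1.
  have h (i : nat) : 0 <= (1 - p i x) ^+ n <= 1.
    have /andP[h0 h1] := p01 i x.
    by rewrite exprn_ge0 ?subr_ge0// exprn_ile1 ?subr_ge0// gerBl.
  apply/andP; split; first by apply: prodr_ge0 => i _; have /andP[] := h i.
  by apply: prodr_ile1 => i _.
split.
- move=> n; apply: Cb2D; first exact: Cb2_cst.
  apply: Cb2N; apply: Cb2_prod => i.
  have C1 : Cb2 (cst 1 - p i) by apply: Cb2D; [exact: Cb2_cst|apply: Cb2N; have [] := pP i].
  rewrite (_ : (fun x => _) = fun x => \prod_(j <- nseq n i) (cst 1 - p i) x).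
    by apply: Cb2_prod.
  by apply/funext => x; rewrite big_nseq iter_mulr mulr1.
- move=> n x; have /andP[q0 q1] := q01 n x.
  by rewrite -[(_ - _) x]/(1 - _) subr_ge0 q1 gerBl.
- move=> n x nOx; rewrite -[(_ - _) x]/(1 - _) big1 ?subrr// => i _.
  by have [_ _ -> //] := pP i; rewrite subr0 expr1n.
- move=> x Ox; have [ab [abx abO]] := open_box oO Ox.
  pose i := pickle ab.
  have [/Cb2P[[[cp _] _] _] _ _ /(_ ab (pickleK ab) abO x abx) px] := pP i.
  have px2 : 0 < p i x / 2 by rewrite divr_gt0.
  have /cvgrPdist_lt/(_ _ px2)/nbhs_normP[e /= e0 eP] := cp x.
  exists e => //.
  (* Near [x] the bump [p i] stays above half its value at [x], so the factor of index [i] is at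
     most [q ^+ n] there and the other factors are at most 1. This factor is present once [n]
     exceeds [i]. *)
  pose q := 1 - p i x / 2.
  have q01' : `|q| < 1.
    have /andP[_ p1] := p01 i x.
    by rewrite /q ger0_norm ?gtrBl// subr_ge0; lra.
  have half0 : (0 : R) < 2^-1 by rewrite invr_gt0.
  have /cvgrPdist_le/(_ _ half0)[n1 _ n1P] := cvg_expr q01'.
  exists (maxn n1 i.+1) => n y; rewrite geq_max => /andP[n1n iin] yx.
  rewrite -[(_ - _) y]/(1 - _).
  have := n1P n n1n; rewrite sub0r normrN /= ler_norml => /andP[_ qn].
  suff : \prod_(j < n) (1 - p j y) ^+ n <= q ^+ n by move: qn; lra.
  rewrite (bigD1 (Ordinal iin))//=.
  have h (j : nat) : 0 <= (1 - p j y) ^+ n <= 1.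
    have /andP[h0 h1] := p01 j y.
    by rewrite exprn_ge0 ?subr_ge0// exprn_ile1 ?subr_ge0// gerBl.
  rewrite -[leRHS]mulr1; apply: ler_pM.
  + by have /andP[] := h i.
  + by apply: prodr_ge0 => j _; have /andP[] := h j.
  + rewrite lerXn2r ?nnegrE ?subr_ge0//.
    * by have /andP[] := p01 i y.
    * have /andP[_ p1] := p01 i x; lra.
    * rewrite /q lerD2l lerN2.
      have := eP y; rewrite /ball_/= distrC => /(_ yx).
      by rewrite ltr_norml => /andP[_]; lra.
  + by apply: prodr_ile1 => j _.
Qed.

End smooth_approximation.

(** * The jump operator on test functions *)

Section taylor.
Variables (R : realType) (d : nat).
Local Notation V := 'rV[R]_d.

Lemma mean_value_bound (phi phi' : R -> R) (c K t : R) :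
  (forall s : R, is_derive s 1 phi (phi' s)) ->
  (forall s, `|s| <= `|t| -> `|phi' s - c| <= K) ->
  `|phi t - phi 0 - c * t| <= K * `|t|.
Proof.
move=> dphi bphi.
have cphi : continuous phi.
  by move=> s; apply: differentiable_continuous; apply/derivable1_diffP; have [] := dphi s.
have [t0|/ltW t0] := leP 0 t.
  have [s s0t ->] := MVT_segment t0 (fun s _ => dphi s) (continuous_subspaceT cphi).
  rewrite subr0 -mulrBl normrM ler_wpM2r// bphi//.
  by move: s0t; rewrite in_itv/= => /andP[s0 st]; rewrite !ger0_norm.
have [s s0t E] := MVT_segment t0 (fun s _ => dphi s) (continuous_subspaceT cphi).
rewrite -[phi t - phi 0]opprB E sub0r mulrN opprK -mulrBl normrM ler_wpM2r// bphi//.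
by move: s0t; rewrite in_itv/= => /andP[s0 st]; rewrite !ler0_norm// lerN2.
Qed.

Lemma is_derive_line (f : V -> R) (i : 'I_d) (z : V) (s : R) :
  (forall x, derivable f x (delta_mx 0 i)) ->
  is_derive s (1 : R) (fun s => f (z + s *: delta_mx 0 i))
    (pderiv i f (z + s *: delta_mx 0 i)).
Proof.
move=> df.
have Eq : (fun h : R => h^-1 *: (((fun s => f (z + s *: delta_mx 0 i)) \o shift s)
      (h *: (1 : R)) - f (z + s *: delta_mx 0 i))) =
    (fun h : R => h^-1 *: ((f \o shift (z + s *: delta_mx 0 i)) (h *: delta_mx 0 i) -
      f (z + s *: delta_mx 0 i))).
  apply/funext => h /=; congr (_ *: (f _ - _)).
  by rewrite -[h *: 1]/(h * 1) mulr1 scalerDl addrCA addrA.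
split; first by rewrite /derivable Eq; exact: df.
by rewrite /derive Eq.
Qed.

(** Coordinates are changed one at a time, with the mean value theorem on each edge; the broken line
    stays in the box of the hypothesis. Only partial derivatives enter. It serves twice in the
    Taylor estimate: with [c] the gradient at [x], and with [c = 0] for the partial derivatives. *)
Lemma increment_bound (f : V -> R) (x y : V) (c : 'I_d -> R) (K : R) :
  (forall i x, derivable f x (delta_mx 0 i)) ->
  (forall i (z : V), (forall j, `|z 0 j - x 0 j| <= `|y 0 j|) -> `|pderiv i f z - c i| <= K) ->
  `|f (x + y) - f x - \sum_i c i * y 0 i| <= K * \sum_i `|y 0 i|.
Proof.
move=> df bf.
pose tr (k : nat) : V := \row_(i < d) (if (i < k)%N then y 0 i else 0).
have tr0 : tr 0%N = 0 by apply/rowP => i; rewrite !mxE.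
have trd : tr d = y by apply/rowP => i; rewrite mxE ltn_ord.
have -> : f (x + y) - f x = \sum_(i < d) (f (x + tr i.+1) - f (x + tr i)).
  rewrite -(big_mkord xpredT (fun i => f (x + tr i.+1) - f (x + tr i))).
  by rewrite (telescope_sumr (fun i => f (x + tr i)))// trd tr0 addr0.
rewrite -sumrB (le_trans (ler_norm_sum _ _ _))// mulr_sumr; apply: ler_sum => i _.
have trS : x + tr i.+1 = x + tr i + y 0 i *: delta_mx 0 i.
  rewrite -addrA; congr (_ + _); apply/rowP => j; rewrite !mxE eqxx /= ltnS leq_eqVlt.
  rewrite eq_sym (inj_eq val_inj) eq_sym; have [->|ij] := eqVneq j i.
    by rewrite /= ltnn mulr1 add0r.
  by rewrite /= mulr0 addr0.
have := @mean_value_bound (fun s => f (x + tr i + s *: delta_mx 0 i))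
  (fun s => pderiv i f (x + tr i + s *: delta_mx 0 i)) (c i) K (y 0 i).
rewrite trS scale0r addr0; apply => [s|s sy].
  exact: is_derive_line.
apply: bf => j; rewrite !mxE eqxx /=.
rewrite [X in `|X|](_ : _ = (if (j < i)%N then y 0 j else 0) + s * (j == i)%:R); last by ring.
have [->|ij] := eqVneq j i; first by rewrite ltnn add0r mulr1.
by rewrite mulr0 addr0; case: ifP; rewrite ?normr0.
Qed.

Lemma coord_sqr_le_dot (y : V) i : y 0 i ^+ 2 <= dot y y.
Proof.
rewrite /dot (bigD1 i)//= -expr2 lerDl sumr_ge0// => j _.
by rewrite -expr2 sqr_ge0.
Qed.

Lemma dot_ge0 (y : V) : 0 <= dot y y.
Proof. by apply: sumr_ge0 => i _; rewrite -expr2 sqr_ge0. Qed.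

Lemma coord_prod_le_dot (y : V) i j : `|y 0 i| * `|y 0 j| <= dot y y.
Proof.
have := coord_sqr_le_dot y i; have := coord_sqr_le_dot y j.
rewrite -[y 0 i ^+ 2]real_normK ?num_real// -[y 0 j ^+ 2]real_normK ?num_real//.
by have := sqr_ge0 (`|y 0 i| - `|y 0 j|); nra.
Qed.

Lemma sum_coord_le (y : V) : \sum_i `|y 0 i| <= d%:R * (1 + dot y y).
Proof.
rewrite mulr_natl -[X in _ *+ X]card_ord -sumr_const; apply: ler_sum => i _.
have := coord_sqr_le_dot y i.
rewrite -[y 0 i ^+ 2]real_normK ?num_real//.
by have := sqr_ge0 (`|y 0 i| - 1); nra.
Qed.

Lemma Cb2_bound (f : V -> R) : Cb2 f -> exists2 K : R, 0 <= K &
  [/\ forall x, `|f x| <= K, forall i x, `|pderiv i f x| <= K &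
      forall i j x, `|pderiv i (pderiv j f) x| <= K].
Proof.
move=> [[_ [K0 h0]] f1 f2].
have /choice[K1 h1] (i : 'I_d) : exists K1, forall x, `|pderiv i f x| <= K1.
  by have [_ [_ [K1 h1]]] := f1 i; exists K1 => x; exact: h1.
have /choice[K2 h2] (ij : 'I_d * 'I_d) : exists K2,
    forall x, `|pderiv ij.1 (pderiv ij.2 f) x| <= K2.
  by have [_ [_ [K2 h2]]] := f2 ij.1 ij.2; exists K2 => x; exact: h2.
have s1 : 0 <= \sum_i `|K1 i| by apply: sumr_ge0.
have s2 : 0 <= \sum_ij `|K2 ij| by apply: sumr_ge0.
exists (`|K0| + \sum_i `|K1 i| + \sum_ij `|K2 ij|); first by rewrite !addr_ge0.
split=> [x|i x|i j x].
- by rewrite (le_trans (h0 x I))// (le_trans (ler_norm _))// -addrA lerDl addr_ge0.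
- rewrite (le_trans (h1 i x))// (le_trans (ler_norm _))// (bigD1 i)//= addrAC addrCA lerDl.
  by rewrite !addr_ge0// sumr_ge0.
- rewrite (le_trans (h2 (i, j) x))// (le_trans (ler_norm _))// (bigD1 (i, j))//= addrCA lerDl.
  by rewrite !addr_ge0// sumr_ge0.
Qed.

Definition levy_integrand (f : V -> R) (x y : V) : R :=
  f (x + y) - f x - dot y (grad f x) / (1 + dot y y).

(** This is the domination that makes the jump term integrable uniformly in [x]: second order at 0,
    bounded at infinity. *)
Lemma levy_integrand_bound (f : V -> R) : Cb2 f -> exists2 K : R, 0 <= K &
  forall x y, `|levy_integrand f x y| <= K * Num.min 1 (dot y y).
Proof.
move=> f2; have [K K0 [b0 b1 b2]] := Cb2_bound f2.
have [_ df1 df2] := f2.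
(* The 2 pays for the two values of [f], [d] for the gradient term, and [d ^ 2] for the second-order
   remainder. *)
exists (K * (2 + d%:R + d%:R ^+ 2)); first by rewrite mulr_ge0// !addr_ge0// exprn_ge0.
move=> x y; set n : R := d%:R; have n0 : 0 <= n by [].
have r0 := dot_ge0 y; set r := dot y y in r0 *.
have dotE : dot y (grad f x) = \sum_i pderiv i f x * y 0 i.
  by apply: eq_bigr => i _; rewrite mxE mulrC.
have dotb : `|dot y (grad f x)| <= K * (n * (1 + r)).
  rewrite dotE (le_trans (ler_norm_sum _ _ _))//.
  apply: (@le_trans _ _ (K * \sum_i `|y 0 i|)).
    by rewrite mulr_sumr; apply: ler_sum => i _; rewrite normrM ler_wpM2r.
  by rewrite ler_wpM2l// sum_coord_le.
have r1 : 0 < 1 + r by lra.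
have near1 : `|f (x + y) - f x - dot y (grad f x)| <= K * n ^+ 2 * r.
  have /le_trans : `|f (x + y) - f x - dot y (grad f x)| <=
      K * (\sum_i `|y 0 i|) * \sum_i `|y 0 i|.
    rewrite dotE; apply: increment_bound => [i|i z zy]; first exact: (df1 i).1.
    rewrite -[pderiv i f z](_ : pderiv i f (x + (z - x)) = _); last by rewrite addrC subrK.
    have := @increment_bound (pderiv i f) x (z - x) (fun=> 0) K.
    have -> : \sum_j 0 * (z - x) 0 j = 0 by rewrite big1// => j _; rewrite mul0r.
    rewrite subr0.
    move=> h; apply: (le_trans (h _ _)) => [j|j w _|].
    - exact: (df2 j i).1.
    - by rewrite subr0.
    - by rewrite ler_wpM2l//; apply: ler_sum => j _; have := zy j; rewrite !mxE.
  apply; rewrite -!mulrA ler_wpM2l// mulr_suml.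
  rewrite [leRHS]mulr_natl -[X in _ *+ X]card_ord -sumr_const.
  apply: ler_sum => i _.
  rewrite mulr_sumr mulr_natl -[X in _ *+ X]card_ord -sumr_const.
  by apply: ler_sum => j _; exact: coord_prod_le_dot.
rewrite /levy_integrand -/r.
have qb : `|dot y (grad f x) / (1 + r)| <= K * n.
  by rewrite normrM normfV (gtr0_norm r1) ler_pdivrMr// -mulrA.
(* For r < 1, treated first, the truncated gradient term differs from the full one by a factor r,
   and the Taylor remainder applies. For r >= 1 the crude bounds suffice. *)
have [r_le1|/ltW r_ge1] := leP 1 r; last first.
- have -> : f (x + y) - f x - dot y (grad f x) / (1 + r) =
     (f (x + y) - f x - dot y (grad f x)) + dot y (grad f x) / (1 + r) * r.
    by field; rewrite gt_eqF.
  rewrite (le_trans (ler_normD _ _))// normrM (ger0_norm r0).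
  have : `|dot y (grad f x) / (1 + r)| * r <= K * n * r by rewrite ler_wpM2r.
  by move: near1; nra.
- rewrite (le_trans (ler_normB _ _))// (le_trans (lerD (ler_normB _ _) qb))//.
  have := b0 (x + y); have := b0 x; rewrite mulr1.
  have : 0 <= K * n ^+ 2 by rewrite mulr_ge0// exprn_ge0.
  by lra.
Qed.

End taylor.

(** * Measurability and boundedness of the operator on test functions *)

Section levy_kernel.
Variables (R : realType) (d : nat).
Local Notation V := 'rV[R]_d.
Variable N : R.-ker V ~> V.
Hypothesis A2 : assumption_A2 N.

Definition away (n : nat) : set V := [set y | n.+1%:R^-1 <= dot y y].

Lemma measurable_dot : measurable_fun setT (fun y : V => dot y y).
Proof.
apply: measurable_sum => i; apply: measurable_funM; exact: measurable_coord.
Qed.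

Lemma measurable_away n : measurable (away n).
Proof.
rewrite (_ : away n = (fun y => dot y y) @^-1` `[n.+1%:R^-1, +oo[).
  by rewrite -[X in measurable X]setTI; exact: measurable_dot.
by apply/seteqP; split => y; rewrite /away /= in_itv/= andbT.
Qed.

Lemma measurable_min_dot : measurable_fun setT (fun y : V => (Num.min 1 (dot y y))%:E).
Proof.
apply/measurable_EFinP; apply: measurable_minr; first exact: measurable_cst.
exact: measurable_dot.
Qed.

Lemma levy_mass_bound : exists2 M : R, 0 <= M &
  forall x, (\int[N x]_y (Num.min 1 (dot y y))%:E <= M%:E)%E.
Proof.
have [_ _] := A2; set S := ereal_sup _ => Soo.
have leS x : (\int[N x]_y (Num.min 1 (dot y y))%:E <= S)%E.
  by apply: ereal_sup_ubound; exists x.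
have S0 : (0 <= S)%E.
  apply: le_trans (leS 0); apply: integral_ge0 => y _.
  by rewrite lee_fin le_min ler01 dot_ge0.
exists (fine S); first exact: fine_ge0.
by move=> x; rewrite fineK// ge0_fin_numE.
Qed.

Lemma levy_away_bound (M : R) n x :
  (\int[N x]_y (Num.min 1 (dot y y))%:E <= M%:E)%E ->
  (N x (away n) <= (n.+1%:R * M)%:E)%E.
Proof.
move=> NM.
have : ((n.+1%:R^-1)%:E * N x (away n) <= M%:E)%E.
  apply: le_trans NM.
  rewrite -[away n]setIT -integral_indic//; last exact: measurable_away.
  rewrite -ge0_integralZl//; last first.
    - by apply/measurable_EFinP; apply: measurable_indic; exact: measurable_away.
  apply: ge0_le_integral => //.
  - by apply/measurable_EFinP/measurable_funM => //; apply: measurable_indic; exact: measurable_away.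
  - exact: measurable_min_dot.
  - move=> y _; rewrite -EFinM lee_fin indicE.
    have [/set_mem yn|_] := boolP (y \in away n).
      by rewrite mulr1 le_min yn andbT invf_le1// ler1n.
    by rewrite mulr0 le_min ler01 dot_ge0.
by rewrite lee_pdivrMl ?ltr0n// EFinM.
Qed.

Lemma bigcup_away (A : set V) x : measurable A ->
  (N x (A `&` away n) @[n --> \oo] --> N x A)%E.
Proof.
move=> mA; have [N0 _ _] := A2.
have mAn n : measurable (A `&` away n) by apply: measurableI => //; exact: measurable_away.
have UA : \bigcup_n (A `&` away n) = A `&` ~` [set 0].
  apply/seteqP; split => y.
    move=> [n _ [Ay /= yn]]; split => // y0; move: yn.
    rewrite /away /= y0 /dot big1 ?leNgt ?invr_gt0 ?ltr0n// => i _.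
    by rewrite mxE mul0r.
  move=> [Ay /= y0]; have dy : 0 < dot y y.
    rewrite lt_neqAle dot_ge0 andbT eq_sym; apply/eqP => dy0; apply: y0.
    apply/rowP => i; rewrite mxE; apply/eqP; rewrite -sqrf_eq0 eq_le sqr_ge0 andbT.
    by rewrite -dy0; exact: coord_sqr_le_dot.
  have [n _ /(_ _ (leqnn n)) nd] := near_infty_natSinv_lt (PosNum dy).
  by exists n => //; split => //; exact: ltW.
have m0 : measurable ([set 0] : set V).
  exact: measurable_row1.
have -> : N x A = N x (\bigcup_n (A `&` away n)).
  rewrite UA; apply/eqP; rewrite eq_le; apply/andP; split; last first.
    apply: le_measure; rewrite ?inE//.
    by apply: measurableI => //; exact: measurableC.
  rewrite -[leLHS](_ : N x ((A `&` ~` [set 0]) `|` (A `&` [set 0])) = _).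
    have mI : measurable (A `&` [set 0]) by exact: measurableI.
    have mD : measurable (A `&` ~` [set 0]) by apply: measurableI => //; exact: measurableC.
    rewrite measureU0//; apply/eqP; rewrite eq_le measure_ge0 andbT -(N0 x).
    by apply: le_measure; rewrite ?inE//; exact: subIsetr.
  by rewrite -setIUr setUC setUv setIT.
apply: nondecreasing_cvg_mu => //.
  exact: bigcupT_measurable.
move=> i j ij; apply/subsetPset => y [Ay /= yi]; split => //=.
by rewrite /away /= (le_trans _ yi)// lef_pV2 ?posrE// ler_nat ltnS.
Qed.

(** The kernel may have infinite mass near 0. On [away n] its mass is bounded uniformly in [x],
    which gives measurability there; since 0 is not charged, the limit in [n] recovers the whole
    section. *)
Lemma measurable_levy_xsection (A : set (V * V)) : measurable A ->
  measurable_fun setT (fun x => N x (xsection A x)).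
Proof.
move=> mA; have [M M0 NM] := levy_mass_bound.
apply: (emeasurable_fun_cvg (fun n x => N x (xsection A x `&` away n))).
  move=> n; have [] := @measurable_prod_subset_xsection_kernel _ _ _ _ _ N
    (away n) (measurable_away n) _ A mA => // x.
  exists (n.+1%:R * M + 1) => X mX; apply: (@le_lt_trans _ _ (N x (away n))).
    have mXn : measurable (X `&` away n) by apply: measurableI => //; exact: measurable_away.
    exact: (le_measure _ (mem_set mXn) (mem_set (measurable_away n)) (@subIsetr _ _ _)).
  by rewrite (le_lt_trans (levy_away_bound n (NM x)))// lte_fin ltrDl.
by move=> x _; apply: bigcup_away; exact: measurable_xsection.
Qed.

Import HBNNSimple.

Lemma measurable_levy_integral (k : V * V -> \bar R) :
  (forall z, 0 <= k z)%E -> measurable_fun setT k ->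
  measurable_fun setT (fun x => \int[N x]_y k (x, y))%E.
Proof.
move=> k0 mk; apply: (measurable_fun_xsection_integral k N
  (nnsfun_approx measurableT mk)).
- by move=> a b ab; exact/nd_nnsfun_approx.
- by move=> z; exact/cvg_nnsfun_approx.
- by move=> n r; apply: measurable_levy_xsection.
Qed.

Lemma measurable_add_fun e (T : measurableType e) (f g : T -> V) :
  measurable_fun setT f -> measurable_fun setT g ->
  measurable_fun setT (fun t => f t + g t).
Proof.
move=> mf mg; apply: measurable_rowP => i.
rewrite (_ : (fun t => _) = (fun t => f t 0 i + g t 0 i)).
  apply: measurable_funD.
    exact: (measurableT_comp (@measurable_coord R d i) mf).
  exact: (measurableT_comp (@measurable_coord R d i) mg).
by apply/funext => t; rewrite mxE.
Qed.

Lemma measurable_levy_integrand (f : V -> R) : Cb2 f ->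
  measurable_fun setT (fun z : V * V => levy_integrand f z.1 z.2).
Proof.
move=> [[cf _] f1 _]; have mf := continuous_measurable cf.
have mfst : measurable_fun setT (fst : V * V -> V) by exact: measurable_fst.
have msnd : measurable_fun setT (snd : V * V -> V) by exact: measurable_snd.
have mc i : measurable_fun setT (fun z : V * V => z.2 0 i).
  exact: (measurableT_comp (@measurable_coord R d i) msnd).
have mg i : measurable_fun setT (fun z : V * V => grad f z.1 0 i).
  rewrite (_ : (fun z => _) = (fun z : V * V => pderiv i f z.1)); last first.
    by apply/funext => z; rewrite mxE.
  have [_ [ci _]] := f1 i.
  exact: (measurableT_comp (continuous_measurable ci) mfst).
apply: measurable_funB.
  apply: measurable_funB; last exact: (measurableT_comp mf mfst).
  exact: (measurableT_comp mf (measurable_add_fun mfst msnd)).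
apply: measurable_funM.
  by apply: measurable_sum => i; exact: measurable_funM.
have -> : (fun z : V * V => (1 + dot z.2 z.2)^-1) =
   (fun z : V * V => (1 + dot z.2 z.2) `^ (- 1)).
  by apply/funext => z; rewrite powRN powRr1// addr_ge0// dot_ge0.
have m1 : measurable_fun setT (fun z : V * V => 1 + dot z.2 z.2).
  apply: measurable_funD; first exact: measurable_cst.
  exact: (measurableT_comp measurable_dot msnd).
exact: (measurableT_comp (measurable_powR (- 1)) m1).
Qed.

Lemma measurable_levy_Rintegral (f : V -> R) : Cb2 f ->
  measurable_fun setT (fun x => \int[N x]_y levy_integrand f x y).
Proof.
move=> f2; have mL := (measurable_EFinP _ _).2 (measurable_levy_integrand f2).
apply: (measurableT_comp (fine_measurable measurableT)) => /=.
rewrite (_ : (fun x => _) = fun x =>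
  (\int[N x]_y (fun z => (levy_integrand f z.1 z.2)%:E)^\+ (x, y) -
   \int[N x]_y (fun z => (levy_integrand f z.1 z.2)%:E)^\- (x, y))%E); last first.
  apply/funext => x; rewrite [LHS]integralE; congr (_ - _)%E; apply: eq_integral => y _.
    by rewrite !funeposE.
  by rewrite !funenegE.
apply: emeasurable_funB; apply: measurable_levy_integral => //.
  exact: measurable_funepos.
exact: measurable_funeneg.
Qed.

Lemma levy_Rintegral_bound (f : V -> R) : Cb2 f ->
  bounded_on setT (fun x => \int[N x]_y levy_integrand f x y).
Proof.
move=> f2; have [M M0 NM] := levy_mass_bound.
have [K K0 Kf] := levy_integrand_bound f2.
exists (K * M) => x _; rewrite /Rintegral.
have mLx : measurable_fun setT (fun y => (levy_integrand f x y)%:E).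
  apply/measurable_EFinP.
  exact: (measurableT_comp (measurable_levy_integrand f2) (pair1_measurable x)).
set I := (\int[N x]_y _)%E.
have IKM : (`|I| <= (K * M)%:E)%E.
  apply: (le_trans (le_abse_integral _ _ _)) => //.
  apply: (@le_trans _ _ (\int[N x]_y (K%:E * (Num.min 1 (dot y y))%:E))%E).
    apply: ge0_le_integral => //.
    - exact: measurableT_comp.
    - by apply: measurable_funeM; exact: measurable_min_dot.
    - by move=> y _; rewrite -EFinM lee_fin.
  rewrite ge0_integralZl//; [|exact: measurable_min_dot|].
    by rewrite EFinM lee_wpmul2l.
  by move=> y _; rewrite lee_fin le_min ler01 dot_ge0.
have If : (I \is a fin_num).
  by rewrite fin_num_abs (le_lt_trans IKM)// ltry.
by rewrite -lee_fin -abse_EFin fineK.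
Qed.

Variables (Q : V -> 'M[R]_d) (b : V -> V).
Hypothesis A1 : assumption_A1 Q b.

Lemma bounded_onM (T : Type) (A : set T) (f g : T -> R) :
  bounded_on A f -> bounded_on A g -> bounded_on A (fun x => f x * g x).
Proof.
move=> [K Kf] [L Lg]; exists (K * L) => x Ax.
by rewrite normrM ler_pM//; [exact: Kf|exact: Lg].
Qed.

Lemma bounded_onD (T : Type) (A : set T) (f g : T -> R) :
  bounded_on A f -> bounded_on A g -> bounded_on A (fun x => f x + g x).
Proof.
move=> [K Kf] [L Lg]; exists (K + L) => x Ax.
by rewrite (le_trans (ler_normD _ _))// lerD//; [exact: Kf|exact: Lg].
Qed.

Lemma bounded_on_sum (T : Type) (A : set T) (I : Type) (r : seq I) (f : I -> T -> R) :
  (forall i, bounded_on A (f i)) -> bounded_on A (fun x => \sum_(i <- r) f i x).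
Proof.
move=> bf; elim: r => [|i r IH].
  by exists 0 => x _; rewrite big_nil normr0.
have [K hK] := bounded_onD (bf i) IH.
by exists K => x Ax; rewrite big_cons; exact: hK.
Qed.

Lemma levy_opE (f : V -> R) : levy_op Q b N f = fun x =>
  2^-1 * (\sum_i \sum_j Q x i j * pderiv j (pderiv i f) x) +
  \sum_i b x 0 i * pderiv i f x + \int[N x]_y levy_integrand f x y.
Proof.
apply/funext => x; rewrite /levy_op; congr (_ * _ + _ + _).
  by apply: eq_bigr => i _; rewrite mxE; apply: eq_bigr => j _; rewrite !mxE.
by apply: eq_bigr => i _; rewrite mxE.
Qed.

Lemma measurable_levy_op (f : V -> R) : Cb2 f -> measurable_fun setT (levy_op Q b N f).
Proof.
move=> f2; have [_ _ mQ mb] := A1; have [_ df1 df2] := f2.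
rewrite levy_opE; apply: measurable_funD; last exact: measurable_levy_Rintegral.
apply: measurable_funD.
  apply: measurable_funM => //.
  apply: measurable_sum => i; apply: measurable_sum => j.
  apply: measurable_funM; first exact: (mQ i j).1.
  by apply: continuous_measurable; exact: (df2 j i).2.1.
apply: measurable_sum => i; apply: measurable_funM; first exact: (mb i).1.
by apply: continuous_measurable; exact: (df1 i).2.1.
Qed.

Lemma levy_op_bounded (f : V -> R) : Cb2 f -> bounded_on setT (levy_op Q b N f).
Proof.
move=> f2; have [_ _ mQ mb] := A1; have [_ df1 df2] := f2.
rewrite levy_opE; apply: bounded_onD; last exact: levy_Rintegral_bound.
apply: bounded_onD.
  apply: bounded_onM; first by exists `|2^-1|.
  apply: bounded_on_sum => i; apply: bounded_on_sum => j.
  apply: bounded_onM; first exact: (mQ i j).2.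
  exact: (df2 j i).2.2.
apply: bounded_on_sum => i; apply: bounded_onM; first exact: (mb i).2.
exact: (df1 i).2.2.
Qed.

Lemma pderiv_vanish (f : V -> R) (G : set V) (i : 'I_d) : open G ->
  (forall x, G x -> f x = 0) -> forall x, G x -> pderiv i f x = 0.
Proof.
move=> oG f0 x Gx; rewrite /pderiv (@near_eq_derive _ _ _ f (cst 0)).
  exact: derive_cst.
by near=> y; apply: f0; near: y; exact: open_nbhs_nbhs.
Unshelve. all: by end_near. Qed.

(** On an open set where [f] vanishes all its derivatives vanish too, so diffusion, drift and
    gradient correction disappear and the jump term alone is left. *)
Lemma levy_op_vanish (f : V -> R) (G : set V) : Cb2 f -> open G ->
  (forall x, 0 <= f x) -> (forall x, G x -> f x = 0) -> forall x, G x ->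
  ((levy_op Q b N f x)%:E = \int[N x]_y (f (x + y))%:E)%E.
Proof.
move=> f2 oG fge0 f0 x Gx; rewrite levy_opE.
have p0 i := pderiv_vanish i oG f0.
have q0 i j := pderiv_vanish i oG (p0 j).
rewrite big1 ?mulr0 ?add0r; last first.
  by move=> i _; rewrite big1// => j _; rewrite q0// mulr0.
rewrite big1 ?add0r; last by move=> i _; rewrite p0// mulr0.
have LE y : levy_integrand f x y = f (x + y).
  rewrite /levy_integrand (f0 x Gx) subr0 /dot big1 ?mul0r ?subr0// => i _.
  by rewrite mxE p0// mulr0.
rewrite /Rintegral; under eq_integral do rewrite LE.
have mf : measurable_fun setT (fun y => (f (x + y))%:E).
  apply/measurable_EFinP; have [[cf _] _ _] := f2.
  apply: (measurableT_comp (continuous_measurable cf)).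
  by apply: measurable_add_fun => //; exact: measurable_cst.
(* The operator is real-valued through [fine], so the identity requires a finite integral;
   domination by [Num.min 1 (dot y y)] supplies it. *)
rewrite fineK// ge0_fin_numE; last by apply: integral_ge0 => y _; rewrite lee_fin.
have [M M0 NM] := levy_mass_bound.
have [K K0 Kf] := levy_integrand_bound f2.
apply: (@le_lt_trans _ _ (\int[N x]_y (K%:E * (Num.min 1 (dot y y))%:E))%E).
  apply: ge0_le_integral => //.
  - by move=> y _; rewrite lee_fin.
  - by apply: measurable_funeM; exact: measurable_min_dot.
  - move=> y _; rewrite -EFinM lee_fin -LE.
    exact: (le_trans (ler_norm _)).
rewrite ge0_integralZl//; [|exact: measurable_min_dot|].
  apply: (@le_lt_trans _ _ (K%:E * M%:E)%E); first by rewrite lee_wpmul2l.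
  by rewrite -EFinM ltry.
by move=> y _; rewrite lee_fin le_min ler01 dot_ge0.
Qed.

End levy_kernel.

(** * The discretised martingale inequality *)

Section martingale_step.
Variables (R : realType) (d : nat).
Local Notation V := 'rV[R]_d.
Local Notation Omega := (skorokhod R d).
Local Notation leb := (@lebesgue_measure R).
Variables (Q : V -> 'M[R]_d) (b : V -> V) (N : R.-ker V ~> V).
Hypothesis A1 : assumption_A1 Q b.
Hypothesis A2 : assumption_A2 N.
Variable Pr : {measure set Omega -> \bar R}.
Hypothesis Pr1 : Pr setT = 1%E.
Hypothesis mgPr : martingale_property Q b N Pr.
Variable D : set V.
Hypothesis D_open : open D.

Lemma measurable_path_fun (h : V -> R) (w : Omega) :
  measurable_fun setT h -> measurable_fun setT (fun r : R => h (w r)).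
Proof.
move=> mh; apply: (measurableT_comp mh).
exact: (measurableT_comp (@measurable_path R d) (pair1_measurable w)).
Qed.

Lemma path_integrable (h : V -> R) (w : Omega) (s t : R) c1 c2 :
  measurable_fun setT h -> bounded_on setT h ->
  leb.-integrable [set` Interval (BSide c1 s) (BSide c2 t)] (EFin \o (fun r => h (w r))).
Proof.
move=> mh [K hK]; apply: measurable_bounded_integrable => //.
- by rewrite /= lebesgue_measure_itv /=; case: ifP => _; rewrite ?ltry// -EFinB ltry.
- by apply: measurable_funTS; exact: measurable_path_fun.
- exists K; split; first exact: num_real.
  by move=> L KL r _; exact: le_trans (hK _ I) (ltW KL).
Qed.

Lemma measurable_path_eintegral (h : V -> \bar R) (i : interval R) :
  measurable_fun setT h -> (forall x, 0 <= h x)%E ->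
  measurable_fun setT (fun w : Omega => \int[leb]_(r in [set` i]) h (w r))%E.
Proof.
move=> mh h0.
pose F (z : Omega * R) : \bar R := ((\1_[set` i] z.2)%:E * h (z.1 z.2))%E.
have mF : measurable_fun setT F.
  apply: emeasurable_funM; last exact: (measurableT_comp mh (@measurable_path R d)).
  apply/measurable_EFinP; apply: measurableT_comp; last exact: measurable_snd.
  exact: measurable_indic.
have := @measurable_fun_fubini_tonelli_F _ _ _ _ _ leb _ mF.
rewrite /fubini_F /F => /(_ _)-H; apply: eq_measurable_fun; last first.
  by apply: H => z; rewrite mule_ge0// lee_fin.
move=> w _; rewrite [RHS]integral_mkcond; apply: eq_integral => r _.
by rewrite patchE indicE; case: (r \in [set` i]); rewrite ?mul1e ?mul0e.
Qed.

Lemma measurable_path_integral (h : V -> R) (i : interval R) :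
  measurable_fun setT h -> (forall x, 0 <= h x) ->
  measurable_fun setT (fun w : Omega => \int[leb]_(r in [set` i]) (h (w r))%:E)%E.
Proof.
move=> mh h0; apply: (@measurable_path_eintegral (EFin \o h)) => [|x].
  exact/measurable_EFinP.
by rewrite lee_fin.
Qed.

Definition stay (s : R) : set Omega :=
  [set w : Omega | D (w s)] `&` [set w : Omega | time_outside D s w = 0%E].

Lemma natural_filtration_stay s : 0 <= s -> natural_filtration s (stay s).
Proof.
move=> s0; have mD : measurable D by exact: measurable_open.
rewrite /natural_filtration; set G := [set C | _].
apply: (@measurableI _ (g_sigma_algebraType G)).
  apply: sub_sigma_algebra; exists s; split; first by rewrite s0 lexx.
  by exists D.
exact: natural_filtration_time_outside.
Qed.

Lemma measurable_stay s : 0 <= s -> measurable (stay s).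
Proof. by move=> s0; apply: natural_filtration_measurable; exact: natural_filtration_stay. Qed.

Lemma measurable_fun_eval (h : V -> R) s : measurable_fun setT h ->
  measurable_fun setT (fun w : Omega => h (w s)).
Proof. by move=> mh; exact: (measurableT_comp mh (@measurable_eval R d s)). Qed.

Lemma eval_integrable (A : set Omega) (h : V -> R) s : measurable A ->
  measurable_fun setT h -> bounded_on setT h ->
  Pr.-integrable A (EFin \o (fun w : Omega => h (w s))).
Proof.
move=> mA mh [K hK]; apply: measurable_bounded_integrable => //.
- apply: (@le_lt_trans _ _ (Pr setT)); last by rewrite Pr1 ltry.
  exact: (le_measure Pr (mem_set mA) (mem_set measurableT)).
- by apply: measurable_funTS; exact: measurable_fun_eval.
- exists K; split; first exact: num_real.
  by move=> L KL r _; exact: le_trans (hK _ I) (ltW KL).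
Qed.

(** On [stay s] the path sits in [D] at time [s], so [f (w s) = 0] and [f (w t)] is a martingale
    increment plus the time integral of Af. The increment integrates to 0 over [stay s], an event of
    the past. The majorant [G] is nonnegative, whereas Af has no sign outside [D]. *)
Lemma martingale_step (f G : V -> R) (s t : R) : Cb2 f ->
  (forall x, D x -> f x = 0) -> 0 <= s <= t ->
  measurable_fun setT G -> bounded_on setT G -> (forall x, 0 <= G x) ->
  (forall x, levy_op Q b N f x <= G x) ->
  (\int[Pr]_(w in stay s) (f (w t))%:E <=
   \int[Pr]_(w in stay s) \int[leb]_(r in `]s, t]) (G (w r))%:E)%E.
Proof.
move=> f2 fD /andP[s0 st] mG bG G0 AfG.
have t0 := le_trans s0 st.
have mA := measurable_stay s0; set A := stay s in mA *.
have [_ M_int M_mart] := mgPr f2.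
have mAf := measurable_levy_op A2 A1 f2; have bAf := levy_op_bounded A2 A1 f2.
set Af := levy_op Q b N f in mAf bAf AfG *.
have [[cf bf] _ _] := f2; have mf := continuous_measurable cf.
pose I (w : Omega) := \int[leb]_(r in `]s, t]) Af (w r).
pose M (r : R) (w : Omega) := f (w r) - f (w 0) - \int[leb]_(q in `[0, r]) Af (w q).
have iM r : 0 <= r -> Pr.-integrable A (EFin \o M r).
  by move=> r0; apply: (integrableS measurableT) => //; exact: M_int.
have IE w : A w -> I w = f (w t) - (M t w - M s w).
  move=> [Dws _]; rewrite /M (fD _ Dws) /I.
  have := @Rintegral_itvB R (fun r => Af (w r)) (BLeft 0) (BRight t) s
    (path_integrable _ _ _ _ _ mAf bAf).
  by rewrite !bnd_simp => /(_ s0 st) <-; ring.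
have iMM : Pr.-integrable A (EFin \o (fun w => M t w - M s w)).
  by apply: (integrableB mA (iM _ t0) (iM _ s0)).
have iF : Pr.-integrable A (EFin \o (fun w : Omega => f (w t))).
  exact: eval_integrable.
(* Integrability of this signed path integral is read off from the identity [IE], without a separate
   measurability argument. *)
have iI : Pr.-integrable A (EFin \o I).
  apply: eq_integrable (integrableB mA iF iMM) => //.
  by move=> w /set_mem Aw; rewrite /= (IE w Aw) EFinB.
have -> : (\int[Pr]_(w in A) (f (w t))%:E = \int[Pr]_(w in A) (I w)%:E)%E.
  rewrite -[LHS]sube0.
  have <- : (\int[Pr]_(w in A) ((M t w)%:E - (M s w)%:E) = 0)%E.
    rewrite integralB_EFin//; [|exact: iM|exact: iM].
    rewrite (M_mart s t _ A (natural_filtration_stay s0)) ?s0//.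
    rewrite subee//; exact: (integrable_fin_num mA (iM _ s0)).
  rewrite -integralB_EFin//.
  by apply: eq_integral => w /set_mem Aw; rewrite (IE w Aw) -!EFinB.
have mPhi : measurable_fun setT (fun w : Omega => \int[leb]_(r in `]s, t]) (G (w r))%:E)%E.
  exact: measurable_path_integral.
have [K GK] := bG.
have leb_st : leb `]s, t] = (t - s)%:E.
  rewrite lebesgue_measure_itv /= lte_fin.
  by have [//|ts] := ltP s t; rewrite (@le_anti _ _ s t) ?st// subrr.
apply: le_integral => //.
  apply: (@le_integrable _ _ _ _ _ mA _ (cst (K * (t - s))%:E)).
  - exact: measurable_funTS.
  - move=> w _ /=; rewrite gee0_abs; last by apply: integral_ge0 => r _; rewrite lee_fin.
    apply: (@le_trans _ _ (\int[leb]_(r in `]s, t]) (cst K%:E r))%E).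
      apply: ge0_le_integral => //.
      - by move=> r _; rewrite lee_fin.
      - apply/measurable_EFinP; apply: measurable_funTS; exact: measurable_path_fun.
      - by move=> r _; rewrite /= lee_fin; exact: le_trans (ler_norm _) (GK _ Logic.I).
    by rewrite integral_cst//= leb_st -EFinM lee_fin ler_norm.
  - have bcst : bounded_on setT (cst (K * (t - s)) : V -> R).
      by exists `|K * (t - s)|.
    exact: (eval_integrable 0 mA (measurable_cst _) bcst).
move=> w _; rewrite /= /I /Rintegral fineK; last first.
  by apply: integrable_fin_num => //; exact: path_integrable.
apply: le_integral => //; [exact: path_integrable..|].
by move=> r _; rewrite lee_fin.
Qed.

End martingale_step.

(** * Summation of the martingale inequality over a grid *)

Section grid_sum.
Variables (R : realType) (d : nat).
Local Notation V := 'rV[R]_d.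
Local Notation Omega := (skorokhod R d).
Local Notation leb := (@lebesgue_measure R).
Variables (Q : V -> 'M[R]_d) (b : V -> V) (N : R.-ker V ~> V).
Hypothesis A1 : assumption_A1 Q b.
Hypothesis A2 : assumption_A2 N.
Variable Pr : {measure set Omega -> \bar R}.
Hypothesis Pr1 : Pr setT = 1%E.
Hypothesis mgPr : martingale_property Q b N Pr.
Variable D : set V.
Hypothesis D_open : open D.

Definition outside (s t : R) (w : Omega) : set R := `]s, t] `&` [set r | ~ D (w r)].

Lemma measurable_outside s t w : measurable (outside s t w).
Proof.
apply: measurableI => //; rewrite (_ : [set r | _] = (fun r : R => w r) @^-1` (~` D))//.
rewrite -[X in measurable X]setTI.
have := measurableT_comp (@measurable_path R d) (pair1_measurable w).
by apply => //; apply: measurableC; exact: measurable_open.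
Qed.

Lemma outside_le s t w : s <= t -> (leb (outside s t w) <= (t - s)%:E)%E.
Proof.
move=> st; apply: (@le_trans _ _ (leb `]s, t])).
  apply: le_measure; rewrite ?inE//; [exact: measurable_outside|exact: subIsetl].
rewrite lebesgue_measure_itv /= lte_fin.
by case: ifP => _; rewrite -?EFinB// lee_fin subr_ge0.
Qed.

Lemma time_outside_le (s t : R) (w : Omega) : s <= t ->
  time_outside D t w = 0%E -> time_outside D s w = 0%E.
Proof.
move=> st ot; have mD := measurable_open D_open.
apply/eqP; rewrite eq_le measure_ge0 andbT -ot.
apply: le_measure; rewrite ?inE//; [exact: measurable_time_outside_section..|].
by move=> r [/andP[r0 rs] Dr]; split => //; rewrite r0 (le_trans rs).
Qed.

(* Once the path has spent positive time outside [D] the events [stay] fail, so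
   at most one grid interval contributes. *)
Lemma outside_sum (h : R) (w : Omega) (m : nat) : 0 <= h ->
  let S := (\sum_(k < m) (\1_(stay D (k%:R * h)) w)%:E *
    leb (outside (k%:R * h) (k.+1%:R * h) w))%E in
  (S <= h%:E)%E /\ (time_outside D (m%:R * h) w = 0%E -> S = 0%E).
Proof.
move=> h0 /=; elim: m => [|m [IH1 IH2]].
  by rewrite big_ord0 lee_fin.
rewrite big_ord_recr /=; set S := (\sum_(k < m) _)%E in IH1 IH2 *.
have mh : m%:R * h <= m.+1%:R * h by rewrite ler_wpM2r// ler_nat.
have mh0 : 0 <= m%:R * h by rewrite mulr_ge0.
split.
  rewrite indicE; have [/set_mem [_ out0]|_] := boolP (w \in _); last first.
    by rewrite mul0e adde0.
  rewrite (IH2 out0) add0e mul1e.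
  by rewrite (le_trans (outside_le _ mh))// lee_fin -mulrBl -natrB// subSnn mul1r.
move=> out0; rewrite (IH2 (time_outside_le mh out0)) add0e.
suff -> : leb (outside (m%:R * h) (m.+1%:R * h) w) = 0%E by rewrite mule0.
apply/eqP; rewrite eq_le measure_ge0 andbT -out0.
apply: le_measure; rewrite ?inE//; first exact: measurable_outside.
  by apply: measurable_time_outside_section; exact: measurable_open.
move=> r []; rewrite /= in_itv/= => /andP[mr rm] Dr; split => //.
by rewrite (le_trans mh0 (ltW mr)).
Qed.

Lemma grid_integral (h : R) (phi : R -> R) (m : nat) : 0 <= h ->
  measurable_fun setT phi -> (forall r, 0 <= phi r) ->
  (\sum_(k < m) \int[leb]_(r in `](k%:R * h)%R, (k.+1%:R * h)%R]) (phi r)%:E =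
   \int[leb]_(r in `]0%R, (m%:R * h)%R]) (phi r)%:E)%E.
Proof.
move=> h0 mphi phi0; elim: m => [|m IH].
  by rewrite big_ord0 mul0r set_itvoc0 integral_set0.
have mh : m%:R * h <= m.+1%:R * h by rewrite ler_wpM2r// ler_nat.
have mh0 : 0 <= m%:R * h by rewrite mulr_ge0.
rewrite big_ord_recr /= IH -ge0_integral_setU//=; last 3 first.
- by apply/measurable_EFinP; exact: measurable_funTS.
- by move=> r _; rewrite lee_fin.
- apply/disj_setPS => r [] /=; rewrite !in_itv/= => /andP[_ rm] /andP[mr _].
  by move: (lt_le_trans mr rm); rewrite ltxx.
congr (integral _ _ _); apply/seteqP; split => r /=; rewrite !in_itv/=.
  move=> [/andP[-> rm]|/andP[mr ->]]; first by rewrite (le_trans rm).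
  by rewrite (le_lt_trans mh0 mr).
move=> /andP[-> ->]; rewrite andbT; have [rm|mr] := leP r (m%:R * h); first by left.
by right.
Qed.

Variable f : V -> R.
Hypothesis f2 : Cb2 f.
Hypothesis f_ge0 : forall x, 0 <= f x.
Hypothesis f_D : forall x, D x -> f x = 0.

Definition jump_rate (x : V) : R := \1_D x * levy_op Q b N f x.

Lemma jump_rateE x : D x -> ((jump_rate x)%:E = \int[N x]_y (f (x + y))%:E)%E.
Proof.
move=> Dx; rewrite /jump_rate indicE mem_set// mul1r.
exact: (levy_op_vanish A2 Q b f2 D_open).
Qed.

Lemma jump_rate_ge0 x : 0 <= jump_rate x.
Proof.
have [Dx|nDx] := pselect (D x).
  rewrite -lee_fin jump_rateE//; apply: integral_ge0 => y _.
  by rewrite lee_fin.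
by rewrite /jump_rate indicE memNset// mul0r.
Qed.

Lemma measurable_jump_rate : measurable_fun setT jump_rate.
Proof.
apply: measurable_funM; last exact: measurable_levy_op.
by apply: measurable_indic; exact: measurable_open.
Qed.

Definition grid_sum (h : R) (n : nat) (w : Omega) : R :=
  \sum_(k < n) \1_(stay D (k%:R * h)) w * f (w (k.+1%:R * h)).

Lemma measurable_grid_sum h n : 0 <= h -> measurable_fun setT (grid_sum h n).
Proof.
move=> h0; apply: measurable_sum => k; apply: measurable_funM.
  by apply: measurable_indic; apply: measurable_stay => //; rewrite mulr_ge0.
apply: measurable_fun_eval; have [[cf _] _ _] := f2.
exact: continuous_measurable.
Qed.

(** [C] depends on [f] but neither on the mesh nor on the number of steps: the time outside [D] that
    is counted over the whole grid is at most one mesh by [outside_sum]. *)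
Lemma grid_sum_bound : exists2 C : R, 0 <= C & forall h n, 0 <= h ->
  (\int[Pr]_w (grid_sum h n w)%:E <=
   \int[Pr]_w \int[leb]_(r in `]0%R, (n%:R * h)%R]) (jump_rate (w r))%:E + (C * h)%:E)%E.
Proof.
have [C0 bC0] := levy_op_bounded A2 A1 f2.
pose C : R := `|C0|; have C_ge0 : 0 <= C by exact: normr_ge0.
have bC x : `|levy_op Q b N f x| <= C := le_trans (bC0 x I) (ler_norm _).
exists C => // h n h0.
(* On [D] this is Af itself, and outside [D] it is the constant [C], which dominates Af. *)
pose G x := jump_rate x + C * \1_(~` D) x.
have mD := measurable_open D_open.
have mDC : measurable_fun setT (fun x => C * \1_(~` D) x).
  by apply: measurable_funM => //; apply: measurable_indic; exact: measurableC.
have mG : measurable_fun setT G.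
  by apply: measurable_funD => //; exact: measurable_jump_rate.
have GD x : D x -> G x = levy_op Q b N f x.
  by move=> Dx; rewrite /G /jump_rate !indicE in_setC mem_set//= mulr0 addr0 mul1r.
have GnD x : ~ D x -> G x = C.
  by move=> Dx; rewrite /G /jump_rate !indicE in_setC memNset//= mulr1 mul0r add0r.
have G_ge0 x : 0 <= G x.
  by rewrite addr_ge0 ?jump_rate_ge0// mulr_ge0.
have bG : bounded_on setT G.
  exists C => x _; have [/GD ->|/GnD ->] := pselect (D x); first exact: bC.
  by rewrite ger0_norm.
have AfG x : levy_op Q b N f x <= G x.
  have [/GD ->//|/GnD ->] := pselect (D x).
  by rewrite (le_trans (ler_norm _)).
have mf : measurable_fun setT f by have [[cf _] _ _] := f2; exact: continuous_measurable.
have mst (k : nat) : measurable (stay D (k%:R * h)).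
  by apply: measurable_stay => //; rewrite mulr_ge0.
have kh (k : nat) : 0 <= k%:R * h <= k.+1%:R * h.
  by rewrite mulr_ge0//= ler_wpM2r// ler_nat.
pose Phi (k : nat) (w : Omega) :=
  (\int[leb]_(r in `](k%:R * h)%R, (k.+1%:R * h)%R]) (jump_rate (w r))%:E)%E.
pose Psi (k : nat) (w : Omega) := leb (outside (k%:R * h) (k.+1%:R * h) w).
have PhiPsi k (w : Omega) : (\int[leb]_(r in `](k%:R * h)%R, (k.+1%:R * h)%R]) (G (w r))%:E =
    Phi k w + C%:E * Psi k w)%E.
  rewrite /G; under eq_integral do rewrite EFinD.
  rewrite ge0_integralD//; last 4 first.
  - by move=> r _; rewrite lee_fin jump_rate_ge0.
  - apply/measurable_EFinP; apply: measurable_funTS; apply: measurable_path_fun.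
    exact: measurable_jump_rate.
  - by move=> r _; rewrite lee_fin mulr_ge0.
  - apply/measurable_EFinP; apply: measurable_funTS.
    exact: (measurable_path_fun w mDC).
  congr (_ + _)%E.
  under eq_integral do rewrite EFinM.
  rewrite ge0_integralZl//; last first.
  - apply/measurable_EFinP; apply: measurable_funTS.
    have mI : measurable_fun setT (\1_(~` D) : V -> R) by apply: measurable_indic; exact: measurableC.
    exact: (measurable_path_fun w mI).
  congr (_ * _)%E; rewrite /Psi /outside setIC -integral_indic//.
  rewrite (_ : [set r | _] = (fun r : R => w r) @^-1` (~` D))//.
  rewrite -[X in measurable X]setTI.
  have := measurableT_comp (@measurable_path R d) (pair1_measurable w).
  by apply => //; exact: measurableC.
have mPhi k : measurable_fun setT (Phi k).
  by apply: measurable_path_integral; [exact: measurable_jump_rate|exact: jump_rate_ge0].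
have mGi (k : nat) : measurable_fun setT
    (fun w => Phi k w + C%:E * Psi k w)%E.
  by under eq_fun do rewrite -PhiPsi; exact: measurable_path_integral.
have Phi0 k w : (0 <= Phi k w)%E.
  by apply: integral_ge0 => r _; rewrite lee_fin jump_rate_ge0.
have Psi0 k w : (0 <= C%:E * Psi k w)%E by rewrite mule_ge0.
have -> : (\int[Pr]_w (grid_sum h n w)%:E =
    \sum_(k < n) \int[Pr]_(w in stay D (k%:R * h)) (f (w (k.+1%:R * h)))%:E)%E.
  rewrite /grid_sum; under eq_integral do rewrite -sumEFin.
  rewrite ge0_integral_sum//; last 2 first.
  - move=> k; apply/measurable_EFinP; apply: measurable_funM; first exact: measurable_indic.
    exact: measurable_fun_eval.
  - by move=> k w _; rewrite lee_fin mulr_ge0.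
  apply: eq_bigr => k _; rewrite [RHS]integral_mkcond; apply: eq_integral => w _.
  by rewrite patchE indicE; case: (w \in _); rewrite ?mul1r ?mul0r.
apply: (@le_trans _ _ (\sum_(k < n) \int[Pr]_w
    ((\1_(stay D (k%:R * h)) w)%:E * (Phi k w + C%:E * Psi k w)))%E).
  apply: lee_sum => k _.
  apply: (le_trans (martingale_step A1 A2 Pr1 mgPr D_open f2 f_D (kh k) mG bG G_ge0 AfG)).
  rewrite [leLHS]integral_mkcond le_eqVlt; apply/orP; left; apply/eqP.
  apply: eq_integral => w _.
  by rewrite patchE indicE PhiPsi; case: (w \in _); rewrite ?mul1e ?mul0e.
rewrite -ge0_integral_sum//; last 2 first.
- move=> k; apply: emeasurable_funM => //.
  by apply/measurable_EFinP; exact: measurable_indic.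
- by move=> k w _; rewrite mule_ge0// ?lee_fin// adde_ge0.
pose total (w : Omega) := (\int[leb]_(r in `]0%R, (n%:R * h)%R]) (jump_rate (w r))%:E)%E.
have mtotal : measurable_fun setT total.
  by apply: measurable_path_integral; [exact: measurable_jump_rate|exact: jump_rate_ge0].
have total0 w : (0 <= total w)%E.
  by apply: integral_ge0 => r _; rewrite lee_fin jump_rate_ge0.
apply: (@le_trans _ _ (\int[Pr]_w (total w + (C * h)%:E))%E).
  apply: ge0_le_integral => //.
  - move=> w _; apply: sume_ge0 => k _.
    by rewrite mule_ge0// ?lee_fin// adde_ge0.
  - apply: emeasurable_sum => k; apply: emeasurable_funM => //.
    by apply/measurable_EFinP; exact: measurable_indic.
  - exact: emeasurable_funD.
  move=> w _.
  (* The indicator is dropped from [Phi k], so that these integrals join into one, but kept on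
     [Psi k], whose sum is bounded by [h] only thanks to it. *)
  apply: (@le_trans _ _ (\sum_(k < n) (Phi k w +
     C%:E * ((\1_(stay D (k%:R * h)) w)%:E * Psi k w)))%E).
    apply: lee_sum => k _; rewrite indicE; case: (w \in _).
      by rewrite !mul1e.
    by rewrite !mul0e mule0 adde0.
  rewrite big_split /= /Phi grid_integral//; last 2 first.
  - by apply: measurable_path_fun; exact: measurable_jump_rate.
  - by move=> r; exact: jump_rate_ge0.
  apply: leeD2l; rewrite -ge0_sume_distrr; last first.
    by move=> k _; rewrite mule_ge0// lee_fin.
  rewrite EFinM lee_wpmul2l// ?lee_fin//.
  exact: (outside_sum w n h0).1.
rewrite ge0_integralD//; last by move=> w _; rewrite lee_fin mulr_ge0.
rewrite leeD2l// integral_cst//= Pr1 mule1//.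
Qed.

End grid_sum.

(** * Exit by a jump *)

Section regularity.
Variables (R : realType) (d : nat).
Local Notation V := 'rV[R]_d.
Variable mu : {measure set V -> \bar R}.
Hypothesis mu_fin : (mu setT < +oo)%E.

(** Inner closed and outer open approximation are required together because complementation
    exchanges them; regular sets then form a sigma-algebra. *)
Definition regular (B : set V) := forall eps : R, 0 < eps ->
  exists F O : set V, [/\ closed F, open O, F `<=` B, B `<=` O &
    (mu (O `\` F) <= eps%:E)%E].

Lemma mu_finW (A : set V) : measurable A -> (mu A < +oo)%E.
Proof.
by move=> mA; apply: le_lt_trans mu_fin; apply: le_measure; rewrite ?inE.
Qed.

Lemma le_mu (A B : set V) : measurable A -> measurable B -> A `<=` B -> (mu A <= mu B)%E.
Proof. by move=> mA mB AB; exact: (le_measure mu (mem_set mA) (mem_set mB) AB). Qed.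

Lemma regular_open (O : set V) : open O -> regular O.
Proof.
move=> oO eps eps0.
(* [F n] collects the points at distance at least 1/(n+1) from the complement. These closed sets
   increase to [O], and finite mass makes the remainder tend to 0. *)
pose F (n : nat) := ~` (\bigcup_(y in ~` O) ball y n.+1%:R^-1).
have cF n : closed (F n).
  by rewrite /F -openC setCK; apply: bigcup_open => y _; exact: ball_open.
have mF n : measurable (F n) by exact: measurable_closed.
have mO : measurable O by exact: measurable_open.
have FO n : F n `<=` O.
  move=> x Fx; apply: contrapT => Ox; apply: Fx; exists x => //.
  by apply: ballxx; rewrite invr_gt0.
have cap0 : \bigcap_n (O `\` F n) = set0.
  apply/seteqP; split => // x xO.
  have Ox : O x by have [] := xO 0%N I.
  have [e /= e0 eO] := (nbhs_ballP _ _).1 (open_nbhs_nbhs (conj oO Ox)).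
  have [n _ /(_ _ (leqnn n)) ne] := near_infty_natSinv_lt (PosNum e0).
  have [_] := xO n I; apply => -[y Oy xy]; apply: Oy; apply: eO.
  by apply: ball_sym; apply: le_ball xy; exact: ltW.
have cvg0 : (mu (O `\` F n) @[n --> \oo] --> (0 : \bar R))%E.
  rewrite -(measure0 mu) -cap0; apply: nonincreasing_cvg_mu.
  - by apply: mu_finW; exact: measurableD.
  - by move=> n; exact: measurableD.
  - by rewrite cap0.
  - move=> m n mn; apply/subsetPset; apply: setDS => x Fx [y Oy xy]; apply: Fx.
    exists y => //; apply: le_ball xy.
    by rewrite lef_pV2 ?posrE// ler_nat ltnS.
have /cvg_ballP/(_ _ eps0) : (fun n => fine (mu (O `\` F n))) @ \oo --> (0 : R).
  by apply: fine_cvg.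
case=> n _ /(_ n (leqnn n)); rewrite /ball /= sub0r normrN => h.
exists (F n), O; split => //.
rewrite -[leLHS]fineK ?lee_fin; last first.
  by rewrite ge0_fin_numE// mu_finW//; exact: measurableD.
by rewrite (le_trans (ler_norm _))// ltW.
Qed.

Lemma regularC (B : set V) : regular B -> regular (~` B).
Proof.
move=> rB eps eps0; have [F [ O [cF oO FB BO muFO]]] := rB _ eps0.
exists (~` O), (~` F); split; rewrite ?closedC ?openC//; [exact: subsetC..|].
by rewrite setDE setCK setIC -setDE.
Qed.

(** Half of [eps] is shared out geometrically among the pieces. The union of the inner closed sets
    need not be closed, so it is truncated to a finite union, which takes the other half. *)
Lemma regular_bigcup (B : nat -> set V) : (forall n, regular (B n)) ->
  regular (\bigcup_n B n).
Proof.
move=> rB eps eps0.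
have e2 : 0 < eps / 2 by rewrite divr_gt0.
have /choice[FG FGP] (n : nat) : exists FG : set V * set V,
    [/\ closed FG.1, open FG.2, FG.1 `<=` B n, B n `<=` FG.2 &
    (mu (FG.2 `\` FG.1) <= (eps / 2 / (2 ^ n.+1)%:R)%:E)%E].
  have [|F [G FGn]] := rB n (eps / 2 / (2 ^ n.+1)%:R).
    by rewrite divr_gt0// ltr0n expn_gt0.
  by exists (F, G).
pose F n := (FG n).1; pose G n := (FG n).2.
have FO n : [/\ closed (F n), open (G n), F n `<=` B n, B n `<=` G n &
    (mu (G n `\` F n) <= (eps / 2 / (2 ^ n.+1)%:R)%:E)%E] by exact: FGP.
have cF n : closed (F n) by have [] := FO n.
have oG n : open (G n) by have [] := FO n.
have mF n : measurable (F n) by exact: measurable_closed.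
have mG n : measurable (G n) by exact: measurable_open.
pose OO := \bigcup_n G n; pose FF n := \big[setU/set0]_(i < n) F i.
have oOO : open OO by apply: bigcup_open.
have mOO := measurable_open oOO.
have cFF n : closed (FF n) by apply: closed_bigsetU.
have mFF n : measurable (FF n) by exact: measurable_closed.
have mFo : measurable (\bigcup_n F n) by exact: bigcupT_measurable.
have small : (mu (OO `\` \bigcup_n F n) <= (eps / 2)%:E)%E.
  apply: (@le_trans _ _ (\sum_(n <oo) mu (G n `\` F n))%E).
    apply: measure_sigma_subadditive => //.
    - by move=> n; exact: measurableD.
    - exact: measurableD.
    - move=> x [[n _ Gnx] nF]; exists n => //; split => // Fx; apply: nF; by exists n.
  have := @epsilon_trick R (fun=> 0%E) (eps / 2) xpredT (fun _ => lexx _) (ltW e2).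
  rewrite [X in (_ <= X + _)%E]eseries0 ?add0e//; apply: le_trans; apply: lee_nneseries => // n _.
  by rewrite add0e; have [] := FO n.
have cvg : (mu (OO `\` FF n) @[n --> \oo] --> mu (OO `\` \bigcup_n F n))%E.
  have -> : OO `\` \bigcup_n F n = \bigcap_n (OO `\` FF n).
    rewrite /FF; apply/seteqP; split => x.
      move=> [Ox nF] n _; split => //; rewrite -bigcup_mkord => -[i _ Fx].
      by apply: nF; exists i.
    move=> h; split; first by have [] := h 0%N I.
    move=> [n _ Fx]; have [_] := h n.+1 I; apply; rewrite -bigcup_mkord.
    by exists n => /=.
  apply: nonincreasing_cvg_mu.
  - by apply: mu_finW; exact: measurableD.
  - by move=> n; exact: measurableD.
  - by apply: bigcapT_measurable => n; exact: measurableD.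
  - move=> m n mn; apply/subsetPset; apply: setDS; exact: subset_bigsetU.
have fin n : mu (OO `\` FF n) \is a fin_num.
  by rewrite ge0_fin_numE// mu_finW//; exact: measurableD.
have fin' : mu (OO `\` \bigcup_n F n) \is a fin_num.
  by rewrite ge0_fin_numE// mu_finW//; exact: measurableD.
have /cvgrPdist_lt/(_ _ e2)[n _ /(_ n (leqnn n)) h] :
    (fun n => fine (mu (OO `\` FF n))) @ \oo --> fine (mu (OO `\` \bigcup_n F n)).
  by apply: fine_cvg; rewrite fineK.
exists (FF n), OO; split => //.
- move=> x; rewrite /FF -bigcup_mkord => -[i _ Fx]; exists i => //.
  by have [_ _ + _ _] := FO i; exact.
- by move=> x [i _ Bx]; exists i => //; have [_ _ _ + _] := FO i; exact.
rewrite -[leLHS]fineK// lee_fin; move: small; rewrite -[leLHS]fineK// lee_fin.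
by move: h; rewrite ltr_norml => /andP[h1 h2] h3; lra.
Qed.

Lemma measurable_regular (B : set V) : measurable B -> regular B.
Proof.
move: B; apply: smallest_sub => [|O oO]; last exact: regular_open.
split.
- by apply: regular_open; exact: open0.
- by move=> B rB; rewrite setTD; exact: regularC.
- exact: regular_bigcup.
Qed.

Lemma outer_regular_null (B : set V) (eps : R) : measurable B -> mu B = 0%E ->
  0 < eps -> exists O, [/\ open O, B `<=` O & (mu O <= eps%:E)%E].
Proof.
move=> mB B0 eps0; have [F [ O [cF oO FB BO h]]] := measurable_regular mB eps0.
exists O; split => //; apply: le_trans h.
have mF := measurable_closed cF; have mO := measurable_open oO.
have F0 : mu F = 0%E by apply/eqP; rewrite eq_le measure_ge0 andbT -B0 le_mu.
have mOF : measurable (O `\` F) by exact: measurableD.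
have -> : mu O = (mu F + mu (O `\` F))%E.
  rewrite -measureU//; first by rewrite setDUK//; exact: subset_trans BO.
  by apply/seteqP; split => // x [Fx []].
by rewrite F0 add0e.
Qed.

End regularity.

(** * The compensator of large jumps out of the domain *)

Section jump_measure.
Variables (R : realType) (d : nat).
Local Notation V := 'rV[R]_d.
Local Notation Omega := (skorokhod R d).
Local Notation leb := (@lebesgue_measure R).
Variable N : R.-ker V ~> V.
Hypothesis A2 : assumption_A2 N.
Variable Pr : {measure set Omega -> \bar R}.
Hypothesis Pr1 : Pr setT = 1%E.
Variable D : set V.
Hypothesis D_open : open D.
Variables (T : R) (n : nat).

Definition jump_section (x : V) (B : set V) : set V :=
  [set y | B (x + y)] `&` away n.

Definition jump_kernel (B : set V) (x : V) : \bar R :=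
  ((\1_D x)%:E * N x (jump_section x B))%E.

Lemma jump_kernel_ge0 B x : (0 <= jump_kernel B x)%E.
Proof. by rewrite /jump_kernel mule_ge0// lee_fin. Qed.

Lemma measurable_jump_section (x : V) (B : set V) : measurable B ->
  measurable (jump_section x B).
Proof.
move=> mB; apply: measurableI; last exact: measurable_away.
rewrite (_ : [set y | _] = (fun y => x + y) @^-1` B)//.
rewrite -[X in measurable X]setTI; apply: (measurable_add_fun (f := cst x) (g := id)) => //.
Qed.

Lemma measurable_jump_kernel B : measurable B -> measurable_fun setT (jump_kernel B).
Proof.
move=> mB; apply: emeasurable_funM.
  by apply/measurable_EFinP; apply: measurable_indic; exact: measurable_open.
pose S : set (V * V) := (fun z => z.1 + z.2) @^-1` B `&` snd @^-1` away n.
have mS : measurable S.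
  apply: measurableI; rewrite -[X in measurable X]setTI.
    apply: (measurable_add_fun (f := fst) (g := snd)) => //.
  by apply: measurable_snd => //; exact: measurable_away.
rewrite (_ : (fun x => _) = fun x => N x (xsection S x)).
  exact: measurable_levy_xsection.
apply/funext => x; congr (N x _); apply/seteqP; split => y; rewrite /xsection /S /= inE//.
Qed.

(* The compensator of the jumps out of [D] of size bounded below; the cutoff
   [away n] makes it finite. *)
Definition jump_measure (B : set V) : \bar R :=
  (\int[Pr]_w \int[leb]_(r in `]0%R, T]) jump_kernel B ((w : Omega) r))%E.

Let jump_measure0 : jump_measure set0 = 0%E.
Proof.
apply: integral0_eq => w _; apply: integral0_eq => r _.
by rewrite /jump_kernel /jump_section set0I measure0 mule0.
Qed.

Let jump_measure_ge0 B : (0 <= jump_measure B)%E.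
Proof.
by apply: integral_ge0 => w _; apply: integral_ge0 => r _; exact: jump_kernel_ge0.
Qed.

Lemma measurable_path_efun (h : V -> \bar R) (w : Omega) :
  measurable_fun setT h -> measurable_fun setT (fun r : R => h (w r)).
Proof.
move=> mh; apply: (measurableT_comp mh).
exact: (measurableT_comp (@measurable_path R d) (pair1_measurable w)).
Qed.

Let jump_measure_additive : semi_sigma_additive jump_measure.
Proof.
move=> F mF tF mUF.
have KE x : jump_kernel (\bigcup_i F i) x = (\sum_(i <oo) jump_kernel (F i) x)%E.
  rewrite /jump_kernel nneseriesZl; last by move=> i _.
  congr (_ * _)%E.
  rewrite (_ : jump_section x _ = \bigcup_i jump_section x (F i)); last first.
    by rewrite /jump_section -setI_bigcupl; congr (_ `&` _).
  apply/esym/cvg_lim => //; apply: measure_semi_sigma_additive.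
  - by move=> i; exact: measurable_jump_section.
  - apply/trivIsetP => i j _ _ ij; move/trivIsetP : tF => /(_ i j I I ij) FE.
    rewrite /jump_section; apply/seteqP; split => // y [[/= Fi _] [/= Fj _]].
    by have : (F i `&` F j) (x + y) by []; rewrite FE.
  - by apply: bigcupT_measurable => i; exact: measurable_jump_section.
have -> : jump_measure (\bigcup_i F i) = (\sum_(i <oo) jump_measure (F i))%E.
  rewrite /jump_measure -integral_nneseries//; last 2 first.
  - move=> i; apply: measurable_path_eintegral; first exact: measurable_jump_kernel.
    exact: jump_kernel_ge0.
  - by move=> i w _; apply: integral_ge0 => r _; exact: jump_kernel_ge0.
  apply: eq_integral => w _; rewrite -integral_nneseries//; last 2 first.
  - by move=> i; apply: measurable_funTS; apply: measurable_path_efun; exact: measurable_jump_kernel.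
  - by move=> i r _; exact: jump_kernel_ge0.
  by apply: eq_integral => r _; exact: KE.
by apply: is_cvg_nneseries => i _ _; exact: jump_measure_ge0.
Qed.

HB.instance Definition _ := isMeasure.Build _ _ _ jump_measure
  jump_measure0 jump_measure_ge0 jump_measure_additive.

Definition jump_meas : {measure set V -> \bar R} := jump_measure.

Lemma jump_measure_fin : (jump_measure setT < +oo)%E.
Proof.
have [M M0 NM] := levy_mass_bound A2.
pose K : R := n.+1%:R * M; have K0 : 0 <= K by rewrite mulr_ge0.
have lebfin : (leb `]0%R, T] < +oo)%E.
  by rewrite lebesgue_measure_itv /=; case: ifP => _; rewrite ?ltry// -EFinB ltry.
apply: (@le_lt_trans _ _ (\int[Pr]_w (K%:E * leb `]0%R, T]))%E).
  apply: ge0_le_integral => //.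
  - by move=> w _; apply: integral_ge0 => r _; exact: jump_kernel_ge0.
  - apply: measurable_path_eintegral; first exact: measurable_jump_kernel.
    exact: jump_kernel_ge0.
  move=> w _; rewrite -integral_cst//.
  apply: ge0_le_integral => //.
  - by move=> r _; exact: jump_kernel_ge0.
  - by apply: measurable_funTS; apply: measurable_path_efun; exact: measurable_jump_kernel.
  move=> r _; rewrite /jump_kernel indicE /=; case: (_ \in _); last by rewrite mul0e lee_fin.
  rewrite mul1e /jump_section (_ : [set y | _] = setT)// setTI.
  exact: levy_away_bound.
rewrite integral_cst//= Pr1 mule1 lte_mul_pinfty//.
Qed.

Lemma jump_measure_null (B : set V) :
  (forall x, D x -> N x [set y | B (x + y)] = 0%E) -> measurable B ->
  jump_measure B = 0%E.
Proof.
move=> B0 mB; apply: integral0_eq => w _; apply: integral0_eq => r _.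
rewrite /jump_kernel indicE; have [/set_mem Dw|_] := boolP (_ \in _); last by rewrite mul0e.
rewrite mul1e; apply: (@subset_measure0 _ _ _ _ _ [set y | B (w r + y)]) => //.
- exact: measurable_jump_section.
- rewrite (_ : [set y | _] = (fun y => w r + y) @^-1` B)//.
  rewrite -[X in measurable X]setTI; apply: (measurable_add_fun (f := cst (w r)) (g := id)) => //.
- by move=> y [].
- exact: B0.
Qed.

End jump_measure.

(** * Exits by a jump into a set not charged by the kernel are negligible *)

Section exit_jump.
Variables (R : realType) (d : nat).
Local Notation V := 'rV[R]_d.
Local Notation Omega := (skorokhod R d).
Local Notation leb := (@lebesgue_measure R).
Variables (Q : V -> 'M[R]_d) (b : V -> V) (N : R.-ker V ~> V).
Hypothesis A1 : assumption_A1 Q b.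
Hypothesis A2 : assumption_A2 N.
Variable Pr : {measure set Omega -> \bar R}.
Hypothesis Pr1 : Pr setT = 1%E.
Hypothesis mgPr : martingale_property Q b N Pr.
Variable D : set V.
Hypothesis D_open : open D.

(** The existential over [tau] is an uncountable union, so this set is never measured directly; it
    is only covered by measurable sets of small probability. *)
Definition exit_jump (T : R) (B : set V) : set Omega :=
  [set w | exists tau : R, [/\ 0 < tau <= T, forall s, 0 <= s < tau -> D (w s) & B (w tau)]].

Lemma sqr_norm_le_dot (v : V) : `|v| ^+ 2 <= dot v v.
Proof.
have [/eqP v0|v0] := boolP (mx_norm v == 0).
  by rewrite [`|v|]v0 expr0n dot_ge0.
have [[i j]] := mx_norm_neq0 v0; rewrite /= ord1 => vj.
by rewrite [`|v|]vj real_normK ?num_real// coord_sqr_le_dot.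
Qed.

(** A jump from [D] into this set has size in [away n]. The interior makes the set open, so that it
    may be intersected with the outer approximation [G]. *)
Definition far (n : nat) : set V := [set z | forall x, D x -> away n (z - x)]°.

Lemma far_cover z : ~ closure D z -> exists n, far n z.
Proof.
move=> nDz; have oC : open (~` closure D) by rewrite openC; exact: closed_closure.
have [e /= e0 eD] := (nbhs_normP _ _).1 (open_nbhs_nbhs (conj oC nDz)).
have e20 : 0 < (e / 2) ^+ 2 by rewrite exprn_gt0// divr_gt0.
have [n _ /(_ _ (leqnn n)) ne] := near_infty_natSinv_lt (PosNum e20).
exists n; suff : nbhs z [set z | forall x, D x -> away n (z - x)] by [].
apply/nbhs_ballP; exists (e / 2) => /=.
  by rewrite divr_gt0.
move=> z'; rewrite -ball_normE /ball_ /= => zz' x Dx; rewrite /away /= (le_trans (ltW ne))//.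
rewrite (le_trans _ (sqr_norm_le_dot _))// lerXn2r ?nnegrE ?divr_ge0 ?(ltW e0)//.
rewrite leNgt; apply/negP => z'x.
apply: (eD x); last exact: subset_closure.
rewrite /ball_ /=; have -> : z - x = (z - z') + (z' - x) by rewrite addrA subrK.
by rewrite (le_lt_trans (ler_normD _ _))// (splitr e) ltrD.
Qed.

Lemma far_away n z x : far n z -> D x -> away n (z - x).
Proof. by move=> /interior_subset; apply. Qed.

Lemma far_notin n z : far n z -> ~ D z.
Proof.
move=> fz Dz; have := far_away fz Dz.
rewrite /away /= subrr /dot big1 ?leNgt ?invr_gt0 ?ltr0n// => i _.
by rewrite mxE mul0r.
Qed.

(** Since [f] is at most the indicator of [O], and every jump from [D] into [O] is already in
    [away n], the cutoff in [jump_kernel] loses nothing. *)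
Lemma jump_rate_le (f : V -> R) (O : set V) (n : nat) x : Cb2 f ->
  (forall z, 0 <= f z <= 1) -> (forall z, ~ O z -> f z = 0) -> open O -> O `<=` far n ->
  ((jump_rate Q b N D f x)%:E <= jump_kernel N D n O x)%E.
Proof.
move=> f2 f01 fO oO Ofar.
have [Dx|nDx] := pselect (D x); last first.
  by rewrite /jump_rate indicE memNset// mul0r jump_kernel_ge0.
have f_ge0 z : 0 <= f z by have /andP[] := f01 z.
have fD z : D z -> f z = 0.
  by move=> Dz; apply: fO => /Ofar/far_notin.
have mO := measurable_open oO.
have mS := measurable_jump_section n x mO.
have mf : measurable_fun setT (fun y => (f (x + y))%:E).
  apply/measurable_EFinP; have [[cf _] _ _] := f2.
  apply: (measurableT_comp (continuous_measurable cf)).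
  by apply: (measurable_add_fun (f := cst x) (g := id)).
rewrite jump_rateE// /jump_kernel indicE mem_set// mul1e.
rewrite -[jump_section n x O]setIT -integral_indic//.
apply: ge0_le_integral => //.
- by move=> y _; rewrite lee_fin.
- by apply/measurable_EFinP; apply: measurable_indic.
move=> y _; rewrite lee_fin indicE.
have [Oxy|nOxy] := pselect (O (x + y)); last by rewrite fO.
rewrite mem_set; first by have /andP[] := f01 (x + y).
split => //; have := far_away (Ofar _ Oxy) Dx.
by rewrite addrC addKr.
Qed.

(** The compensator and the mesh error contribute [eps / 4] each. Markov's inequality at level 1/2
    doubles the sum [eps / 2], which bounds each [Yj j] by [eps]. *)
Lemma exit_jump_small (T : R) (B : set V) (n : nat) (eps : R) : 0 < T -> 0 < eps ->
  measurable B -> (forall x, D x -> N x [set y | B (x + y)] = 0%E) -> B `<=` far n ->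
  exists Y, [/\ measurable Y, exit_jump T B `<=` Y & (Pr Y <= eps%:E)%E].
Proof.
move=> T0 eps0 mB B0 Bfar.
have e4 : 0 < eps / 4 by rewrite divr_gt0.
pose kappa := jump_meas A2 Pr D_open T n.
have [G [oG BG kG]] := outer_regular_null (mu := kappa)
  (jump_measure_fin A2 Pr1 D_open T n) mB (jump_measure_null Pr T n B0 mB) e4.
pose O := G `&` far n.
have oO : open O by apply: openI => //; exact: open_interior.
have mO := measurable_open oO; have mG := measurable_open oG.
have BO : B `<=` O by move=> x Bx; split; [exact: BG|exact: Bfar].
have kO : (kappa O <= (eps / 4)%:E)%E.
  apply: le_trans kG.
  by apply: (le_measure kappa (mem_set mO) (mem_set mG)) => x [].
have Ofar : O `<=` far n by move=> x [].
have [f [f2 f01 fO fnear]] := ex_open_approx oO.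
have f_ge0 j z : 0 <= f j z by have /andP[] := f01 j z.
have fD j z : D z -> f j z = 0 by move=> Dz; apply: fO => /Ofar/far_notin.
have /choice[C CP] (j : nat) : exists C : R, 0 <= C /\ forall h k, 0 <= h ->
    (\int[Pr]_w (grid_sum D (f j) h k w)%:E <=
     \int[Pr]_w \int[leb]_(r in `]0%R, (k%:R * h)%R])
       (jump_rate Q b N D (f j) (w r))%:E + (C * h)%:E)%E.
  have [C C0 CP] := grid_sum_bound A1 A2 Pr1 mgPr D_open (f2 j) (f_ge0 j) (fD j).
  by exists C.
have /choice[m mP] (j : nat) : exists k : nat,
    C j * (T / k.+1%:R) <= eps / 4 /\ T / k.+1%:R <= j.+1%:R^-1.
  have [C0 _] := CP j.
  (* The mesh is picked after [f j], as [C j] may grow with [j]; it also tends to 0, which catches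
     the jump time. The 1 added to [C j] avoids a division by 0. *)
  have e1 : 0 < Num.min (eps / 4 / ((C j + 1) * T)) (j.+1%:R^-1 / T).
    by rewrite lt_min !divr_gt0// mulr_gt0// ltr_wpDl.
  have [k _ /(_ _ (leqnn k))] := near_infty_natSinv_lt (PosNum e1).
  rewrite /= lt_min => /andP[]; rewrite ltr_pdivlMr ?mulr_gt0 ?ltr_wpDl// => h1.
  rewrite ltr_pdivlMr// => h2; exists k; split; last by rewrite mulrC ltW.
  apply: le_trans (ltW h1); rewrite mulrA mulrC ler_wpM2l// ler_wpM2r//; first exact: ltW.
  by rewrite lerDl.
pose h j := T / (m j).+1%:R.
have h0 j : 0 < h j by rewrite divr_gt0.
have mh j : (m j).+1%:R * h j = T by rewrite /h mulrC divfK.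
pose Yj j := [set w : Omega | 2^-1 <= grid_sum D (f j) (h j) (m j).+1 w].
have mgs j : measurable_fun setT (grid_sum D (f j) (h j) (m j).+1).
  by apply: measurable_grid_sum => //; exact: ltW.
have mYj j : measurable (Yj j).
  rewrite (_ : Yj j = grid_sum D (f j) (h j) (m j).+1 @^-1` `[2^-1, +oo[).
    by rewrite -[X in measurable X]setTI; exact: mgs.
  by apply/seteqP; split => w; rewrite /Yj /= in_itv/= andbT.
have gs_ge0 j w : 0 <= grid_sum D (f j) (h j) (m j).+1 w.
  by apply: sumr_ge0 => k _; rewrite mulr_ge0.
have PYj j : (Pr (Yj j) <= eps%:E)%E.
  have : ((2^-1)%:E * Pr (Yj j) <= (eps / 2)%:E)%E.
    apply: (@le_trans _ _ (\int[Pr]_w (grid_sum D (f j) (h j) (m j).+1 w)%:E)%E).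
      rewrite -[Yj j]setIT -integral_indic// -ge0_integralZl//; last first.
        by apply/measurable_EFinP; exact: measurable_indic.
      apply: ge0_le_integral => //.
      - by apply/measurable_EFinP; apply: measurable_funM => //; exact: measurable_indic.
      - exact/measurable_EFinP.
      move=> w _; rewrite -EFinM lee_fin indicE.
      have [/set_mem Yw|_] := boolP (w \in _); last by rewrite mulr0 gs_ge0.
      by rewrite mulr1.
    have [_ /(_ (h j) (m j).+1 (ltW (h0 j)))/le_trans] := CP j; apply.
    rewrite mh (_ : eps / 2 = eps / 4 + eps / 4); last by field.
    rewrite EFinD leeD//; last by have [h1 _] := mP j; rewrite lee_fin.
    apply: le_trans kO; rewrite /kappa /= /jump_measure.
    have jr0 x : 0 <= jump_rate Q b N D (f j) x by apply: jump_rate_ge0 => //; exact: fD.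
    have mjr : measurable_fun setT (jump_rate Q b N D (f j)).
      exact: measurable_jump_rate.
    apply: ge0_le_integral => //.
    - by move=> w _; apply: integral_ge0 => r _; rewrite lee_fin.
    - exact: measurable_path_integral.
    - apply: measurable_path_eintegral; first exact: measurable_jump_kernel.
      exact: jump_kernel_ge0.
    move=> w _; apply: ge0_le_integral => //.
    - by move=> r _; rewrite lee_fin.
    - by apply/measurable_EFinP; apply: measurable_funTS; exact: measurable_path_fun.
    - apply: measurable_funTS; apply: measurable_path_efun.
      exact: measurable_jump_kernel.
    by move=> r _; exact: (jump_rate_le _ (f2 j) (f01 j) (fO j) oO Ofar).
  by rewrite lee_pdivrMl// -EFinM mulrC divfK.
(* The cover is the lower limit of the events [Yj j]: a given exit path is detected by all large
   [j], with a threshold that depends on the path. *)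
pose Y i := \bigcap_(j in [set j | (i <= j)%N]) Yj j.
have mY i : measurable (Y i) by apply: bigcap_measurableType => j _; exact: mYj.
exists (\bigcup_i Y i); split.
- exact: bigcupT_measurable.
- move=> w [tau [/andP[tau0 tauT] stayD Bw]].
  have [e e0 [n0 near_f]] := fnear _ (BO _ Bw).
  have [del del0 wdel] := path_right_continuous w tau e0.
  have [n1 _ /(_ _ (leqnn n1)) n1d] := near_infty_natSinv_lt (PosNum del0).
  exists (maxn n0 n1) => // j /=; rewrite geq_max => /andP[n0j n1j].
  have hdel : h j < del.
    have [_ h1] := mP j; rewrite (le_lt_trans h1)// (le_lt_trans _ n1d)//.
    by rewrite lef_pV2 ?posrE// ler_nat ltnS.
  (* Minimality of [k] places [tau] in the grid interval from [k%:R * h j], excluded, to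
     [k.+1%:R * h j], included. The path is in [D] at the left end and has spent no time outside. *)
  have exk : exists k : nat, tau <= k.+1%:R * h j by exists (m j); rewrite mh.
  case: (ex_minnP exk) => k tauk kmin.
  have km : (k <= m j)%N by apply: kmin; rewrite mh.
  have ktau : k%:R * h j < tau.
    case: k {km} tauk kmin => [|k] tauk kmin; first by rewrite mul0r.
    by rewrite ltNge; apply/negP => /kmin; rewrite ltnn.
  have k0 : 0 <= k%:R * h j by rewrite mulr_ge0// ltW.
  have wk : stay D (k%:R * h j) w.
    split; first by apply: stayD; rewrite k0.
    rewrite /= /time_outside (_ : [set s | _] = set0) ?measure0//.
    apply/seteqP; split => // s [/andP[s0 sk]]; apply; apply: stayD.
    by rewrite s0 (le_lt_trans sk).
  rewrite /Yj /= /grid_sum (bigD1 (Ordinal (km : (k < (m j).+1)%N)))//=.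
  rewrite indicE mem_set// mul1r ler_wpDr//.
    by apply: sumr_ge0 => i _; rewrite mulr_ge0.
  (* The right end of the interval is less than [del] after [tau], so right-continuity keeps the
     path close to its landing point, where [f j] is at least 1/2. *)
  apply: near_f => //; apply: wdel; rewrite tauk /=.
  by rewrite -natr1 mulrDl mul1r ltrD.
have cvgY : (Pr (Y i) @[i --> \oo] --> Pr (\bigcup_i Y i))%E.
  apply: nondecreasing_cvg_mu => //; first exact: bigcupT_measurable.
  move=> i i' ii'; apply/subsetPset => w Yw j /= i'j; apply: Yw.
  exact: leq_trans i'j.
have cY : cvg (Pr (Y i) @[i --> \oo]) by apply/cvg_ex; eexists; exact: cvgY.
rewrite -(cvg_lim _ cvgY)//; apply: lime_le => //; apply: nearW => i.
apply: le_trans (PYj i).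
by apply: (le_measure Pr (mem_set (mY i)) (mem_set (mYj i))) => w; apply => /=.
Qed.

Theorem exit_jump_negligible (T : R) (B : set V) : 0 < T ->
  measurable B -> (forall x, D x -> N x [set y | B (x + y)] = 0%E) ->
  (forall z, B z -> ~ closure D z) -> Pr.-negligible (exit_jump T B).
Proof.
move=> T0 mB B0 BD.
have mfar n : measurable (far n) by apply: measurable_open; exact: open_interior.
have -> : exit_jump T B = \bigcup_n exit_jump T (B `&` far n).
  apply/seteqP; split => [w [tau [h1 h2 Bw]]|w [n _ [tau [h1 h2 [Bw _]]]]].
    by have [n fn] := far_cover (BD _ Bw); exists n => //; exists tau; split.
  by exists tau; split.
apply: negligible_bigcup => n.
have /choice[Y YP] (k : nat) : exists Y, [/\ measurable Y,
    exit_jump T (B `&` far n) `<=` Y & (Pr Y <= (k.+1%:R^-1)%:E)%E].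
  apply: (exit_jump_small (n := n)) => //; first exact: measurableI.
    move=> x Dx; apply: (subset_measure0 _ _ _ (B0 x Dx)); last by move=> y [].
    - have mI : measurable (B `&` far n) by exact: measurableI.
      rewrite -[X in measurable X]setTI.
      by apply: (measurable_add_fun (f := cst x) (g := id) _ _ _ mI).
    - rewrite -[X in measurable X]setTI.
      by apply: (measurable_add_fun (f := cst x) (g := id) _ _ _ mB).
exists (\bigcap_k Y k); split.
- by apply: bigcapT_measurable => k; have [] := YP k.
- apply/eqP; rewrite eq_le measure_ge0 andbT; apply/lee_addgt0Pr => e e0.
  rewrite add0e; have [k _ /(_ _ (leqnn k)) ke] := near_infty_natSinv_lt (PosNum e0).
  have [mYk _ Yk] := YP k.
  apply: (@le_trans _ _ (Pr (Y k))).
    apply: le_measure; rewrite ?inE//; last by move=> w; apply.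
    by apply: bigcapT_measurable => i; have [] := YP i.
  by rewrite (le_trans Yk)// lee_fin ltW.
- by move=> w Zw k _; have [_ + _] := YP k; apply.
Qed.

End exit_jump.

(** * The quantitative estimate *)

Section lower_integral.
Context (e : measure_display) (T : measurableType e) (R : realType).
Variable mu : {measure set T -> \bar R}.
Local Open Scope ereal_scope.

Import HBNNSimple.

(* The library integral of a nonnegative function that is not known to be
   measurable is a supremum over simple functions below it. *)
Lemma lower_integral_approx (f : T -> \bar R) (r : \bar R) : (forall x, 0 <= f x) ->
  r < \int[mu]_x f x -> exists h : T -> R,
    [/\ measurable_fun setT h, forall x, (0 <= h x)%R, forall x, (h x)%:E <= f x &
      r < \int[mu]_x (h x)%:E].
Proof.
move=> f0; rewrite ge0_integralTE// => /ereal_sup_gt[_ [h /= hf <-] rh].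
exists h; split => //; rewrite integral_nnsfun//.
by rewrite patch_setT.
Qed.

Lemma le_lower_integral (f g : T -> \bar R) : (forall x, 0 <= f x) ->
  (forall x, f x <= g x) -> \int[mu]_x f x <= \int[mu]_x g x.
Proof.
move=> f0 fg; have g0 x : 0 <= g x := le_trans (f0 x) (fg x).
rewrite !ge0_integralTE//; apply: le_ereal_sup => _ [h /= hf <-].
by exists h => // x; exact: le_trans (fg x).
Qed.

(** A simple function below [f] is below [H] almost everywhere, so its integral is at most that of
    [H]; the supremum inherits the bound. *)
Lemma lower_integral_le_ae (f : T -> \bar R) (H : T -> R) (Z : set T) :
  (forall x, 0 <= f x) -> measurable_fun setT H -> (forall x, (0 <= H x)%R) ->
  mu.-negligible Z -> (forall x, ~ Z x -> f x <= (H x)%:E) ->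
  \int[mu]_x f x <= \int[mu]_x (H x)%:E.
Proof.
move=> f0 mH H0 nZ fH; rewrite leNgt; apply/negP => /(lower_integral_approx f0).
case=> h [mh h0 hf]; apply/negP; rewrite -leNgt.
apply: ae_ge0_le_integral => //.
- by move=> x _; rewrite lee_fin.
- exact/measurable_EFinP.
- by move=> x _; rewrite lee_fin.
- exact/measurable_EFinP.
apply: negligibleS nZ => x /= nh; apply: contrapT => /fH fHx; apply: nh => _.
exact: le_trans fHx.
Qed.

(** The null set is removed from [H]: multiplied by the indicator of the complement of a measurable
    null cover, [H] lies below [g] everywhere and keeps its integral. *)
Lemma le_ae_lower_integral (g : T -> \bar R) (H : T -> R) (Z : set T) :
  (forall x, 0 <= g x) -> measurable_fun setT H -> (forall x, (0 <= H x)%R) ->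
  mu.-negligible Z -> (forall x, ~ Z x -> (H x)%:E <= g x) ->
  \int[mu]_x (H x)%:E <= \int[mu]_x g x.
Proof.
move=> g0 mH H0 [Y [mY Y0 ZY]] gH.
have mHY : measurable_fun setT (fun x => H x * \1_(~` Y) x)%R.
  by apply: measurable_funM => //; apply: measurable_indic; exact: measurableC.
apply: (@le_trans _ _ (\int[mu]_x (H x * \1_(~` Y) x)%:E)).
  rewrite le_eqVlt; apply/orP; left; apply/eqP; apply: ge0_ae_eq_integral => //.
  - exact/measurable_EFinP.
  - exact/measurable_EFinP.
  - by move=> x _; rewrite lee_fin.
  - by move=> x _; rewrite lee_fin mulr_ge0.
  exists Y; split => // x /= nE; apply: contrapT => nYx; apply: nE => _.
  by rewrite indicE mem_set// mulr1.
apply: le_lower_integral => x; first by rewrite lee_fin mulr_ge0.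
rewrite indicE; have [/set_mem nYx|_] := boolP (x \in _); last by rewrite mulr0.
by rewrite mulr1; apply: gH => Zx; apply: nYx; exact: ZY.
Qed.

End lower_integral.

Section exit_time_facts.
Variables (R : realType) (d : nat).
Local Notation V := 'rV[R]_d.
Local Notation Omega := (skorokhod R d).
Variable D : set V.
Hypothesis D_open : open D.

Lemma exit_time_gt_in (w : Omega) (s : R) : 0 < s -> (s%:E < exit_time D w)%E -> D (w s).
Proof.
move=> s0 sw; apply: contrapT => nD; move: sw; apply/negP; rewrite -leNgt.
by apply: ereal_inf_lbound; exists s.
Qed.

Lemma exit_time_gt0 (w : Omega) : D (w 0) -> (0 < exit_time D w)%E.
Proof.
move=> Dw; have [e /= e0 eD] := (nbhs_normP _ _).1 (open_nbhs_nbhs (conj D_open Dw)).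
have [del del0 wdel] := path_right_continuous w 0 e0.
apply: (@lt_le_trans _ _ del%:E); first by rewrite lte_fin.
apply: le_ereal_inf_tmp => _ [s [s0 nD] <-]; rewrite lee_fin leNgt; apply/negP => sdel.
apply: nD; apply: eD; rewrite /ball_ /= distrC; apply: wdel.
by rewrite ltW//= add0r.
Qed.

Lemma exit_time_minP (w : Omega) (t : R) : D (w 0) -> 0 < t ->
  [/\ 0 < exit_time_min D t w <= t,
      forall s, 0 <= s < exit_time_min D t w -> D (w s) &
      forall s, s <= t -> (s%:E < exit_time D w)%E -> s <= exit_time_min D t w].
Proof.
move=> Dw t0; have E0 := exit_time_gt0 Dw.
have mE : (Order.min (exit_time D w) t%:E = (exit_time_min D t w)%:E)%E.
  rewrite /exit_time_min fineK// fin_numElt; apply/andP; split.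
    by rewrite lt_min ltNyr andbT (lt_trans _ E0).
  by rewrite gt_min ltry orbT.
split.
- by rewrite -!lte_fin -lee_fin -mE lt_min E0 lte_fin t0 ge_min lexx orbT.
- move=> s /andP[]; rewrite le_eqVlt => /orP[/eqP <- //|s0].
  rewrite -lte_fin -mE lt_min => /andP[sE _]; exact: exit_time_gt_in.
- by move=> s st sE; rewrite -lee_fin -mE le_min (ltW sE) lee_fin.
Qed.

End exit_time_facts.

Section support.
Variables (R : realType) (d : nat).
Local Notation V := 'rV[R]_d.

(** Each point off the support has a null open neighbourhood, hence a null rational box, and there
    are countably many such boxes. No finiteness of [mu] enters. *)
Lemma measure_support_null (mu : {measure set V -> \bar R}) (A : set V) :
  measurable A -> (forall y, A y -> ~ measure_support mu y) -> mu A = 0%E.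
Proof.
move=> mA nA.
pose bx (ab : 'rV[rat]_d * 'rV[rat]_d) : set V := box (map_mx ratr ab.1) (map_mx ratr ab.2).
have : mu.-negligible (\bigcup_k (if @unpickle ('rV[rat]_d * 'rV[rat]_d)%type k is Some ab
    then [set y | bx ab y /\ mu.-negligible (bx ab)] else set0)).
  apply: negligible_bigcup => k; case: unpickle => [ab|]; last exact: negligible_set0.
  have [nab|nab] := pselect (mu.-negligible (bx ab)); first by apply: negligibleS nab => y [].
  by apply: negligibleS (negligible_set0 mu) => y [].
move=> nU; apply: measure_negligible => //; apply: negligibleS nU => y Ay.
have [U [oU Uy U0]] : exists U, [/\ open U, U y & mu U = 0%E].
  apply: contrapT => nU; apply: (nA _ Ay) => U oU Uy.
  rewrite lt0e measure_ge0 andbT; apply/eqP => U0; apply: nU; by exists U.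
have [ab [aby abU]] := open_box oU Uy.
exists (pickle ab) => //; rewrite pickleK; split => //.
by exists U; split => //; exact: measurable_open.
Qed.

End support.

(** * The subsolution inequality along surviving paths *)

Section hopf_estimate.
Variables (R : realType) (d : nat).
Local Notation V := 'rV[R]_d.
Local Notation Omega := (skorokhod R d).
Local Notation leb := (@lebesgue_measure R).
Variables (Q : V -> 'M[R]_d) (b : V -> V) (N : R.-ker V ~> V).
Variables (P : R.-pker V ~> Omega) (D : set V) (c g phi u : V -> R) (lambda : R).
Variable m : {measure set V -> \bar R}.
Hypothesis A1 : assumption_A1 Q b.
Hypothesis A2 : assumption_A2 N.
Hypothesis A3 : assumption_A3 D c.
Hypothesis A4 : strong_markov_solution Q b N P.
Hypothesis D_open : open D.
Hypothesis g_le0 : forall x, D x -> g x <= 0.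
Hypothesis Eig : principal_pair P D m lambda phi.
Hypothesis u_sub : Uplus P D c g N u.
Variable x : V.
Hypothesis Dx : D x.
Hypothesis phi_ub : has_ubound (phi @` D).
Hypothesis phi_x : 0 < phi x.

Let ubar := sup (u @` closure_S N D).
Let M := sup (phi @` D).
Let cinf := inf (c @` D).
Let csup := sup (c @` D).
Let gam := inf ((fun y => Num.max (- g y) 0) @` D).

Let ubar_ge0 : 0 <= ubar. Proof. by have [] := u_sub. Qed.

Lemma u_le_ubar z : closure_S N D z -> u z <= ubar.
Proof.
move=> Dz; have [[[_ [K uK]] _] _] := u_sub.
apply: sup_ubound; last by exists z.
by exists K => _ [y _ <-]; rewrite (le_trans (ler_norm _))// uK.
Qed.

Let bad : set V := [set z | ubar < u z].

Let measurable_bad : measurable bad.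
Proof.
have [[[mu _] _] _] := u_sub.
rewrite (_ : bad = u @^-1` `]ubar, +oo[).
  by rewrite -[X in measurable X]setTI; exact: mu.
by apply/seteqP; split => z; rewrite /bad /= in_itv/= andbT.
Qed.

Let bad_closure z : bad z -> ~ closure D z.
Proof.
rewrite /bad /= => uz cDz; move: uz; rewrite ltNge => /negP; apply.
apply: u_le_ubar; have [Dz|nDz] := pselect (D z); first by left.
by right; left; split => // /interior_subset.
Qed.

Let bad_jump z : D z -> N z [set y | bad (z + y)] = 0%E.
Proof.
move=> Dz; apply: measure_support_null.
  rewrite -[X in measurable X]setTI.
  by apply: (measurable_add_fun (f := cst z) (g := id) _ _ _ measurable_bad).
move=> y; rewrite /bad /= => uzy sy; move: uzy; rewrite ltNge => /negP; apply.
apply: u_le_ubar; have [Dzy|nDzy] := pselect (D (z + y)); first by left.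
by right; right; split => //; exists z => //; exists y.
Qed.

Definition null_paths (t : R) : set Omega := [set w : Omega | w 0 <> x] `|` exit_jump D t bad.

Lemma null_paths_negligible t : 0 < t -> (P x).-negligible (null_paths t).
Proof.
move=> t0; have [P0 mgP _ _] := A4; apply: negligibleU; last first.
  apply: (exit_jump_negligible A1 A2 (prob_kernel x) (mgP x) D_open t0 measurable_bad bad_jump).
  exact: bad_closure.
have mx : measurable [set w : Omega | w 0 = x].
  have := @measurable_eval R d 0 measurableT _ (measurable_row1 x).
  by rewrite setTI.
exists (~` [set w : Omega | w 0 = x]); split => //.
- exact: measurableC.
- have fin : (P x setT < +oo)%E by rewrite prob_kernel ltry.
  have := measureD measurableT mx fin.
  rewrite setTD setTI => ->; rewrite [X in (X - _)%E](prob_kernel (s := P) x) [X in (_ - X)%E](P0 x) subee//.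
Qed.

(** If [u] exceeded [ubar] at the stopped time, that time would itself witness [exit_jump]: the path
    is in [D] before it and in [bad] at it. *)
Lemma good_path (t : R) (w : Omega) : 0 < t -> ~ null_paths t w ->
  let T := exit_time_min D t w in
  [/\ 0 < T <= t, forall s, 0 <= s < T -> D (w s), u (w T) <= ubar &
      forall s, s <= t -> (s%:E < exit_time D w)%E -> s <= T].
Proof.
move=> t0 good T; have w0 : w 0 = x by apply: contrapT => w0; apply: good; left.
have Dw0 : D (w 0) by rewrite w0.
have [T0 TD sT] := exit_time_minP D_open Dw0 t0; split => //.
rewrite leNgt; apply/negP => uT; apply: good; right.
by exists T.
Qed.

Let c_bound y : D y -> cinf <= c y <= csup.
Proof.
move=> Dy; have [_ c0 [K cK]] := A3; apply/andP; split.
  by apply: inf_lbound; [exists 0 => _ [z Dz <-]; exact: c0|exists y].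
apply: sup_ubound; last by exists y.
by exists K => _ [z Dz <-]; rewrite (le_trans (ler_norm _))// cK.
Qed.

Let cinf_ge0 : 0 <= cinf.
Proof.
have [_ c0 _] := A3; apply: lb_le_inf; first by exists (c x); exists x.
by move=> _ [z Dz <-]; exact: c0.
Qed.

Let csup_ge0 : 0 <= csup.
Proof. by apply: le_trans cinf_ge0 _; have /andP[/le_trans] := c_bound Dx; apply. Qed.

(** [c] is controlled only on [D]. The half-open interval leaves out the position at time [T], so
    [c] may be replaced by its extension by 0. *)
Lemma killing_bounds (w : Omega) (T : R) : 0 <= T -> (forall s, 0 <= s < T -> D (w s)) ->
  cinf * T <= \int[leb]_(r in `[0, T[) c (w r) <= csup * T.
Proof.
move=> T0 TD; have [mc c0 [K cK]] := A3; have mD := measurable_open D_open.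
have E : \int[leb]_(r in `[0, T[) c (w r) = \int[leb]_(r in `[0, T[) (c \_ D) (w r).
  apply: eq_Rintegral => r /set_mem; rewrite /= in_itv/= => rT.
  by rewrite patchE mem_set//; exact: TD.
have mcD : measurable_fun setT (c \_ D) by exact/(measurable_restrictT _ mD).
have bcD : bounded_on setT (c \_ D).
  exists `|K| => y _; rewrite patchE; case: ifPn => [/set_mem Dy|_]; last by rewrite normr0.
  by rewrite (le_trans (cK y Dy))// ler_norm.
have icD := path_integrable w 0 T true true mcD bcD.
have icst (k : R) : leb.-integrable `[0, T[ (EFin \o (fun=> k)).
  by apply: (path_integrable w 0 T true true (measurable_cst k)); exists `|k|.
have lT : fine (leb `[0, T[) = T.
  rewrite lebesgue_measure_itv /= lte_fin; have [//|T0'] := ltP 0 T; first by rewrite oppr0 addr0.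
  by apply/esym/eqP; rewrite eq_le T0 T0'.
rewrite E -[X in cinf * X]lT -[X in csup * X]lT -!Rintegral_cst//.
apply/andP; split; apply: le_Rintegral => // r /=; rewrite in_itv/= => rT;
  by rewrite patchE mem_set; [have /andP[] := c_bound (TD _ rT)|exact: TD].
Qed.

Let M_gt0 : 0 < M.
Proof. by apply: (lt_le_trans phi_x); apply: sup_ubound => //; exists x. Qed.

Let gam_ge0 : 0 <= gam.
Proof.
apply: lb_le_inf; first by eexists; exists x.
by move=> _ [y Dy <-]; rewrite le_max lexx orbT.
Qed.

Let gam_le y : D y -> gam <= - g y.
Proof.
move=> Dy; rewrite -(@max_l _ _ (- g y) 0) ?oppr_ge0 ?g_le0//.
by apply: inf_lbound; [exists 0 => _ [z Dz <-]; rewrite le_max lexx orbT|exists y].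
Qed.

(** Half the value of the killed semigroup on [phi], not divided by [M]: the minorant [h] below
    takes values in [0, M], and the division by [M] appears in the coefficients of the two
    estimates. *)
Definition half_survival (s : R) : R := expR (- lambda * s) * phi x / 2.

(* A measurable minorant of the possibly non-measurable survival indicator,
   which retains half of the mass given by the eigenfunction. *)
Lemma ex_survival (s : R) : 0 < s -> exists h : Omega -> R,
  [/\ measurable_fun setT h, forall w, 0 <= h w <= M,
      forall w, 0 < h w -> (s%:E < exit_time D w)%E &
      ((half_survival s)%:E <= \int[P x]_w (h w)%:E)%E].
Proof.
move=> s0; have [_ [_ phi0] _ /(_ s x (ltW s0) Dx)] := Eig.
rewrite /killed_semigroup integral_mkcond; set F := _ \_ _ => EF.
have F0 w : (0 <= F w)%E.
  rewrite /F patchE; case: ifPn => // /set_mem sw; rewrite lee_fin phi0//.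
  exact: exit_time_gt_in sw.
have [||h [mh h0 hF hI]] := @lower_integral_approx _ _ _ (P x) F (half_survival s)%:E.
- exact: F0.
- by rewrite EF lte_fin /half_survival gtr_pMr ?mulr_gt0 ?expR_gt0// invf_lt1// ltr1n.
exists h; split => //; last exact: ltW.
- move=> w; rewrite h0 /=; have := hF w; rewrite /F patchE; case: ifPn => [/set_mem sw|_].
    rewrite lee_fin => /le_trans; apply; apply: sup_ubound => //.
    by exists (w s) => //; exact: exit_time_gt_in sw.
  by rewrite lee_fin => /le_trans; apply; exact: ltW.
- move=> w hw; have := hF w; rewrite /F patchE; case: ifPn => [/set_mem //|_].
  by rewrite lee_fin leNgt hw.
Qed.

Lemma exp_c_le (w : Omega) (s T : R) : 0 <= s <= T -> (forall r, 0 <= r < T -> D (w r)) ->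
  exp_c c T w <= expR (- (cinf * s)).
Proof.
move=> /andP[s0 sT] TD; have T0 := le_trans s0 sT.
rewrite /exp_c ler_expR lerN2; have /andP[+ _] := killing_bounds T0 TD.
by apply: le_trans; rewrite ler_wpM2l.
Qed.

Lemma le_exp_c (w : Omega) (r s T : R) : 0 <= r <= s -> r <= T ->
  (forall r, 0 <= r < T -> D (w r)) -> expR (- (csup * s)) <= exp_c c r w.
Proof.
move=> /andP[r0 rs] rT TD; rewrite /exp_c ler_expR lerN2.
have TDr q : 0 <= q < r -> D (w q).
  by move=> /andP[q0 qr]; apply: TD; rewrite q0 (lt_le_trans qr).
have /andP[_ h] := killing_bounds r0 TDr.
by apply: le_trans h _; rewrite ler_wpM2l.
Qed.

(** Pathwise the integrand is at most [ubar - k * h w]. Where [h] is positive the path survives [s],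
    so discounting saves at least ubar (1 - exp(- cinf s)), and this dominates [k * h w] because [h]
    is at most [M]. *)
Lemma terminal_part_le (s t : R) : 0 < s <= t ->
  (\int[P x]_w (exp_c c (exit_time_min D t w) w * u (w (exit_time_min D t w)))%:E <=
   (ubar - ubar * (1 - expR (- (cinf * s))) / M * half_survival s)%:E)%E.
Proof.
move=> /andP[s0 st]; have t0 := lt_le_trans s0 st.
have [h [mh hM hs hI]] := ex_survival s0.
have [k kE] : exists k, k = ubar * (1 - expR (- (cinf * s))) / M by eexists.
rewrite -kE.
have e1 : expR (- (cinf * s)) <= 1.
  by rewrite -expR0 ler_expR oppr_le0 mulr_ge0// ltW.
have k0 : 0 <= k by rewrite kE divr_ge0 ?(ltW M_gt0)// mulr_ge0// subr_ge0.
have kM : k * M = ubar * (1 - expR (- (cinf * s))) by rewrite kE divfK// gt_eqF.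
have khub w : k * h w <= ubar * (1 - expR (- (cinf * s))).
  by rewrite -kM ler_wpM2l//; have /andP[] := hM w.
have e0 := expR_ge0 (- (cinf * s)).
have H0 w : 0 <= ubar - k * h w.
  by rewrite subr_ge0 (le_trans (khub w))// ler_piMr// gerBl.
have mH : measurable_fun setT (fun w => ubar - k * h w).
  by apply: measurable_funB => //; exact: measurable_funM.
(* The integrand involves the exit time and may fail to be measurable. Discarding its negative part
   leaves a nonnegative function, to which the lower integral bounds apply. *)
rewrite integralE; apply: le_trans (geeDl _ _) _.
  by rewrite oppe_le0; apply: integral_ge0.
apply: (@le_trans _ _ (\int[P x]_w (ubar - k * h w)%:E)%E).
  apply: (lower_integral_le_ae _ mH H0 (null_paths_negligible t0)) => // w good.
  have [/andP[T0 Tt] TD uT sT] := good_path t0 good.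
  rewrite funeposE; set T := exit_time_min D t w in T0 Tt TD uT sT *.
  rewrite -EFin_max lee_fin ge_max H0 andbT.
  have ec0 : 0 <= exp_c c T w by exact: expR_ge0.
  apply: (@le_trans _ _ (exp_c c T w * ubar)); first by rewrite ler_wpM2l.
  have [hw|hw] := ltP 0 (h w).
    have sT' := sT _ st (hs _ hw).
    apply: (@le_trans _ _ (expR (- (cinf * s)) * ubar)).
      by rewrite ler_wpM2r//; apply: exp_c_le => //; rewrite (ltW s0).
    by have := khub w; lra.
  (* Without guaranteed survival only a discount of at most 1 is available; the bound by [ubar] then
     rests on [ubar] being nonnegative. *)
  have -> : h w = 0 by apply/eqP; rewrite eq_le hw; have /andP[->] := hM w.
  rewrite mulr0 subr0 ler_piMl//.
  have := @exp_c_le w 0 T; rewrite mulr0 oppr0 expR0; apply => //.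
  by rewrite lexx ltW.
have ih : (P x).-integrable setT (EFin \o h).
  apply: measurable_bounded_integrable => //; first by rewrite prob_kernel ltry.
  exists M; split; first exact: num_real.
  move=> L ML w _; have /andP[h0 h1] := hM w.
  by rewrite /= ger0_norm// (le_trans h1)// ltW.
have ifin := integrable_fin_num measurableT ih.
under eq_integral do rewrite EFinB EFinM.
rewrite integralB//; last 2 first.
- apply: measurable_bounded_integrable => //; first by rewrite prob_kernel ltry.
  by exists ubar; split; [exact: num_real|move=> L ML w _; rewrite /= ger0_norm// ltW].
- exact: integrableZl.
rewrite integral_cst// integralZl// EFinB EFinM.
apply: leeB; last by rewrite lee_wpmul2l// lee_fin.
by rewrite [X in (_ * X)%E](prob_kernel (s := P) x) mule1.
Qed.

(** Off the null paths the inner integrand is nonpositive, so the positive part vanishes and the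
    whole estimate is a lower bound of the negative part by [k * h w]. *)
Lemma source_part_le (s t : R) : 0 < s <= t ->
  (\int[P x]_w \int[leb]_(r in `[0%R, exit_time_min D t w[) (exp_c c r w * g (w r))%:E <=
   (- (gam * s * expR (- (csup * s)) / M * half_survival s))%:E)%E.
Proof.
move=> /andP[s0 st]; have t0 := lt_le_trans s0 st.
have [h [mh hM hs hI]] := ex_survival s0.
have [k kE] : exists k, k = gam * s * expR (- (csup * s)) / M by eexists.
rewrite -kE.
have k0 : 0 <= k by rewrite kE divr_ge0 ?(ltW M_gt0)// !mulr_ge0 ?expR_ge0 ?(ltW s0).
have kM : k * M = gam * s * expR (- (csup * s)) by rewrite kE divfK// gt_eqF.
have mH : measurable_fun setT (fun w => k * h w) by exact: measurable_funM.
have H0 w : 0 <= k * h w by rewrite mulr_ge0//; have /andP[] := hM w.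
set J := fun w : Omega => (\int[leb]_(r in `[0%R, exit_time_min D t w[)
  (exp_c c r w * g (w r))%:E)%E.
have JE w : ~ null_paths t w -> J w = (- \int[leb]_(r in `[0%R, exit_time_min D t w[)
    ((fun r => (exp_c c r w * g (w r))%:E)^\- r))%E.
  move=> good; have [_ TD _ _] := good_path t0 good.
  rewrite /J integralE integral0_eq ?sub0e// => r; rewrite /= in_itv/= => rT.
  rewrite funeposE -EFin_max max_r// mulr_ge0_le0 ?expR_ge0// g_le0//.
  exact: TD.
have JN w : ~ null_paths t w -> ((k * h w)%:E <= J^\- w)%E.
  move=> good; have [/andP[T0 Tt] TD _ sT] := good_path t0 good.
  rewrite funenegE; have [hw|hw] := ltP 0 (h w); last first.
    have -> : h w = 0 by apply/eqP; rewrite eq_le hw; have /andP[->] := hM w.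
    by rewrite mulr0 le_max lexx orbT.
  have sT' := sT _ st (hs _ hw).
  rewrite le_max (JE _ good) oppeK; apply/orP; left.
  (* Only the time before [s] is kept: there the discount is at least exp(- csup s) and - g is at
     least [gam]. *)
  apply: (@le_trans _ _ (\int[leb]_(r in `[0%R, s[) (gam * expR (- (csup * s)))%:E)%E).
    rewrite integral_cst//= lebesgue_measure_itv /= lte_fin s0 oppr0 addr0 -EFinM lee_fin.
    rewrite mulrAC -kM ler_wpM2l//; by have /andP[] := hM w.
  rewrite integral_mkcond [leRHS]integral_mkcond; apply: le_lower_integral => r.
    by rewrite patchE; case: ifP => // _; rewrite lee_fin mulr_ge0// expR_ge0.
  rewrite !patchE; case: ifPn => [/set_mem|_]; last by case: ifP => _ //; exact: funeneg_ge0.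
  rewrite /= in_itv/= => /andP[r0 rs]; rewrite mem_set/=; last first.
    by rewrite in_itv/= r0 (lt_le_trans rs).
  rewrite funenegE le_max -EFinN lee_fin -(mulrN (exp_c c r w)) [leLHS]mulrC; apply/orP; left.
  apply: ler_pM => //.
    apply: (le_exp_c _ _ TD); first by rewrite r0 ltW.
    by rewrite (le_trans (ltW rs)).
  by apply: gam_le; apply: TD; rewrite r0 (lt_le_trans rs).
have JP w : ~ null_paths t w -> (J^\+ w <= 0%:E)%E.
  move=> good; rewrite funeposE (JE _ good) ge_max lexx andbT oppe_le0.
  by apply: integral_ge0 => r _.
have int_pos : (\int[P x]_w (J^\+ w) <= 0)%E.
  apply: le_trans (lower_integral_le_ae (H := fun=> 0) _ _ _ (null_paths_negligible t0) JP) _ => //.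
  by rewrite integral0_eq.
have int_neg : ((k * half_survival s)%:E <= \int[P x]_w (J^\- w))%E.
  apply: le_trans (le_ae_lower_integral _ mH H0 (null_paths_negligible t0) JN) => //.
  under eq_integral do rewrite EFinM.
  rewrite ge0_integralZl//; last 2 first.
  - exact/measurable_EFinP.
  - by move=> w _; rewrite lee_fin; have /andP[] := hM w.
  by rewrite EFinM lee_wpmul2l.
rewrite integralE -/J -[leRHS]add0e EFinN.
exact: leeB int_pos int_neg.
Qed.

(** The subsolution inequality is used once, at the horizon [Num.max s1 s2], which leaves the
    survival times of the two parts free to be chosen separately. *)
Lemma hopf_bound (s1 s2 : R) : 0 < s1 -> 0 < s2 ->
  ubar * (1 - expR (- (cinf * s1))) / M * half_survival s1 +
  gam * s2 * expR (- (csup * s2)) / M * half_survival s2 <= ubar - u x.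
Proof.
move=> s10 s20; have [[_ us] _] := u_sub.
pose t := Num.max s1 s2.
have t0 : 0 <= t by rewrite le_max (ltW s10).
have := us x t Dx t0.
have s1t : 0 < s1 <= t by rewrite s10 le_max lexx.
have s2t : 0 < s2 <= t by rewrite s20 le_max lexx orbT.
move=> /le_trans/(_ (leeD (terminal_part_le s1t) (source_part_le s2t))).
by rewrite -EFinD lee_fin; lra.
Qed.

End hopf_estimate.

(** Take s = 1 / (l + a) and p = a / (l + a). The right-hand side of the first inequality becomes
    exp(p) - 1, which is at least p; the second inequality is an equality. *)
Lemma ex_optimal_time (R : realType) (l a : R) : 0 <= l -> 0 <= a ->
  exists s, [/\ 0 < s,
    a / (l + a) <= expR 1 * ((1 - expR (- (a * s))) * expR (- l * s)) &
    (l + a)^-1 <= expR 1 * (s * expR (- (a * s)) * expR (- l * s))].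
Proof.
move=> l0 a0; have [la0|la0] := eqVneq (l + a) 0.
  (* When [l + a] is 0 both left-hand sides are 0, the inverse of 0 being 0, and any positive time
     would do. *)
  exists 1; rewrite la0 invr0 mulr0; split => //.
  have e1 : expR (- (a * 1)) <= 1 :> R by rewrite -expR0 ler_expR oppr_le0 mulr_ge0.
  by rewrite !mulr_ge0 ?expR_ge0// subr_ge0.
have la : 0 < l + a by rewrite lt_neqAle eq_sym la0 addr_ge0.
exists (l + a)^-1; split; first by rewrite invr_gt0.
- have -> : - l * (l + a)^-1 = a / (l + a) - 1 by field.
  set p := a / (l + a).
  rewrite mulrCA -expRD mulrBl mul1r -expRD.
  have -> : 1 + (p - 1) = p by ring.
  by rewrite addNr expR0 lerBrDr addrC expR_ge1Dx.
- rewrite -mulrA -expRD mulrCA -expRD.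
  have -> : 1 + (- (a / (l + a)) + - l / (l + a)) = 0 by field.
  by rewrite expR0 mulr1.
Qed.

Theorem theorem7p2 (R : realType) (d : nat) (D : set 'rV[R]_d)
    (D_open : open D) (D_connected : connected D)
    (Q : 'rV[R]_d -> 'M[R]_d) (b : 'rV[R]_d -> 'rV[R]_d)
    (N : R.-ker 'rV[R]_d ~> 'rV[R]_d) (c : 'rV[R]_d -> R)
    (P : R.-pker 'rV[R]_d ~> skorokhod R d)
    (A1 : assumption_A1 Q b) (A2 : assumption_A2 N) (A3 : assumption_A3 D c)
    (A4 : strong_markov_solution Q b N P) (ET : exits_as P D)
    (g : 'rV[R]_d -> R) (g_borel : measurable_fun D g)
    (g_le0 : forall x, D x -> g x <= 0)
    (m : {measure set 'rV[R]_d -> \bar R})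
    (m_sigma_finite : sigma_finite D m) (m_nontrivial : m D <> 0%E)
    (lambda : R) (phi : 'rV[R]_d -> R) (Eig : principal_pair P D m lambda phi)
    (u : 'rV[R]_d -> R) (u_sub : Uplus P D c g N u)
    (x : 'rV[R]_d) (Dx : D x) :
  hopf_rhs D lambda phi c g (sup (u @` closure_S N D)) x <=
    sup (u @` closure_S N D) - u x.
Proof.
have u_le : 0 <= sup (u @` closure_S N D) - u x.
  by rewrite subr_ge0; apply: (u_le_ubar u_sub); left.
rewrite /hopf_rhs; case: asboolP => // phi_ub.
have [lambda0 [_ phi0] _ _] := Eig.
have := phi0 x Dx; rewrite le_eqVlt => /orP[/eqP <-|phi_x]; first by rewrite !mul0r.
have [_ c0 [K cK]] := A3.
have cinf0 : 0 <= inf (c @` D).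
  by apply: lb_le_inf => [|_ [z Dz <-]]; [exists (c x); exists x|exact: c0].
have csup0 : 0 <= sup (c @` D).
  apply: le_trans (c0 x Dx) _; apply: ub_le_sup; last by exists x.
  by exists K => _ [z Dz <-]; rewrite (le_trans (ler_norm _))// cK.
have [s1 [s10 h1 _]] := ex_optimal_time lambda0 cinf0.
have [s2 [s20 _ h2]] := ex_optimal_time lambda0 csup0.
have := hopf_bound A1 A2 A3 A4 D_open g_le0 Eig u_sub Dx phi_ub phi_x s10 s20.
apply: le_trans; rewrite /half_survival.
have M0 : 0 < sup (phi @` D).
  by apply: (lt_le_trans phi_x); apply: ub_le_sup => //; exists x.
have gam0 : 0 <= inf ((fun y => Num.max (- g y) 0) @` D).
  apply: lb_le_inf; first by eexists; exists x.
  by move=> _ [y Dy <-]; rewrite le_max lexx orbT.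
have [_ ubar0] := u_sub.
set M := sup (phi @` D) in M0 *; set gam := inf _ in gam0 *.
set ubar := sup (u @` _) in ubar0 *.
set ci := inf (c @` D) in h1 *; set cs := sup (c @` D) in h2 *.
have e0 : 0 < expR 1 :> R by exact: expR_gt0.
(* The 2 undoes the half in [half_survival], [expR 1] is the loss in [ex_optimal_time], and [M] is
   the bound on the survival minorant. *)
pose k := phi x / (2 * expR 1 * M); have k0 : 0 <= k.
  by rewrite divr_ge0 ?(ltW phi_x)// !mulr_ge0// ltW.
rewrite -/k.
apply: (@le_trans _ _
  (k * (ubar * (expR 1 * ((1 - expR (- (ci * s1))) * expR (- lambda * s1))) +
        gam * (expR 1 * (s2 * expR (- (cs * s2)) * expR (- lambda * s2)))))).
  rewrite ler_wpM2l// lerD//; last by rewrite ler_wpM2l.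
  by rewrite [ci * ubar]mulrC -mulrA ler_wpM2l.
rewrite le_eqVlt; apply/orP; left; apply/eqP; rewrite /k.
by field; rewrite !gt_eqF.
Qed.
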